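(* Let $\mathbb{Q}$ be the space of rational numbers with its usual topology. The space $C_k(\mathbb{Q})$ contains a copy of $\varphi$ but does not contain any complemented copy of $\varphi$. Hence the Asplund space $C_k(\mathbb{Q})$ contains a closed vector subspace (isomorphic to $\varphi$) which is not a Gâteaux Differentiability Space.
   Context: All vector spaces are real; all topological vector spaces are Hausdorff; ''lcs'' means locally convex space. $C_k(X)$ is the space of continuous real-valued functions on $X$ with the compact-open topology. $\varphi$ denotes an $\aleph_0$-dimensional vector space endowed with the finest locally convex topology. A copy of $\varphi$ in a lcs is a vector subspace which, with the induced topology, is linearly homeomorphic to $\varphi$; it is complemented if it is the range of a continuous linear projection of the whole space. A lcs $E$ is Asplund if every continuous convex function $f:D\to\mathbb{R}$, where $D\subset E$ is a nonempty open convex set, is Fréchet differentiable on a dense $G_\delta$ subset of $D$. $E$ is a Gâteaux Differentiability Space (GDS) if every such function is Gâteaux differentiable on a dense subset of $D$. Here $f$ is Gâteaux differentiable at $x\in D$ if there is $x^*\in E'$ with $\lim_{t\to0}\frac{f(x+ty)-f(x)}{t}=x^*(y)$ for every $y\in E$, and Fréchet differentiable at $x$ if moreover the limit is uniform for $y$ in each bounded subset of $E$. *)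

(* Defs.v *)
From HB Require Import structures.
From mathcomp Require Import all_boot all_order all_algebra.
From mathcomp Require Import interval_inference.
From mathcomp Require Import all_classical all_reals all_analysis.
From mathcomp Require Import borel_hierarchy.

Set Implicit Arguments.
Unset Strict Implicit.
Unset Printing Implicit Defensive.

Import Order.TTheory GRing.Theory Num.Theory.
Import numFieldNormedType.Exports.

Local Open Scope classical_set_scope.
Local Open Scope ring_scope.

Section disks.
Context {R : realType} {V : lmodType R}.
Implicit Types A : set V.

Definition balanced A := forall (t : R) x, `|t| <= 1 -> A x -> A (t *: x).

Definition absolutely_convex A := convex_set A /\ balanced A.

Definition absorbing A :=
  forall x, exists2 d : R, 0 < d & forall t : R, `|t| < d -> A (t *: x).

Lemma convex_setP A : convex_set A <->
  (forall x y (t : R), 0 <= t -> t <= 1 -> A x -> A y ->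
     A (t *: x + (1 - t) *: y)).
Proof.
split=> [cA x y t t0 t1 Ax Ay|cA x y l /set_mem Ax /set_mem Ay].
  have t01 : (Itv.spec (Itv.num_sem (R := R)) (Itv.Real `[0, 1]%Z) t).
    by rewrite /= /Itv.num_sem /= in_itv /= t0 t1 (ger0_real t0).
  have /set_mem := cA x y (Itv.mk t01) (mem_set Ax) (mem_set Ay).
  by [].
by apply/mem_set/cA.
Qed.

End disks.

Section disk_topology.
Context {R : realType} {E : preTopologicalLmodType R}.
Variable B : set (set E).
Hypothesis nbhsB : forall (x : E) (U : set E),
  nbhs x U <-> exists2 b, B b & forall y, b (y - x) -> U y.
Hypothesis acB : forall b, B b -> absolutely_convex b.
Hypothesis absB : forall b, B b -> absorbing b.
Hypothesis scB : forall b (r : R), B b -> 0 < r ->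
  exists2 c, B c & forall y, c y -> b (r *: y).

Let half b : B b ->
  exists2 c, B c & forall y z, c y -> c z -> b (y + z).
Proof.
move=> Bb; have [c Bc cb] := scB Bb (ltr0n R 2).
exists c => // y z /cb cy /cb cz.
have /convex_setP/(_ _ _ (2^-1 : R) _ _ cy cz) := (acB Bb).1.
rewrite !scalerA mulVf// scale1r.
have -> : (1 - 2^-1) * 2 = 1 :> R.
  by rewrite mulrBl mul1r mulVf//; exact: (addrK 1 1).
rewrite scale1r; apply; first by rewrite invr_ge0.
by rewrite invf_le1// ler1n.
Qed.

Lemma disk_add_continuous : continuous (fun x : E * E => x.1 + x.2).
Proof.
move=> [x y] U /nbhsB[b Bb bU] /=.
have [c Bc cb] := half Bb.
exists ([set z | c (z - x)], [set z | c (z - y)]) => /=.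
  by split; apply/nbhsB; exists c.
move=> [z w] /= [cz cw]; apply: bU.
by rewrite opprD addrACA; exact: cb.
Qed.

Lemma disk_scale_continuous : continuous (fun z : R^o * E => z.1 *: z.2).
Proof.
move=> [r x] U /nbhsB[b Bb bU] /=.
have [c Bc cb] := half Bb.
have [d d0 dx] := absB Bc x.
have M0 : 0 < `|r| + 1 by rewrite ltr_wpDl.
have [c' Bc' c'c] := scB Bc M0.
exists ([set s : R^o | `|s - r| < Num.min d 1], [set z | c' (z - x)]) => /=.
  split; last by apply/nbhsB; exists c'.
  exists (Num.min d 1) => /=; first by rewrite lt_min d0 ltr01.
  by move=> s /=; rewrite distrC.
move=> [s z] /= [+ c'z]; rewrite lt_min => /andP[sd s1]; apply: bU.
rewrite (_ : _ - _ = s *: (z - x) + (s - r) *: x); last first.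
  by rewrite scalerBr scalerBl addrA subrK.
apply: cb; last exact: dx.
rewrite (_ : s *: _ = (s / (`|r| + 1)) *: ((`|r| + 1) *: (z - x))); last first.
  by rewrite scalerA divfK// gt_eqF.
apply: (acB Bc).2; last exact: c'c.
rewrite normrM normfV (gtr0_norm M0) ler_pdivrMr// mul1r.
by rewrite -[s](subrK r) addrC (le_trans (ler_normD _ _))// lerD2l ltW.
Qed.

Lemma disk_locally_convex :
  exists2 F : set_system E, (forall b, b \in F -> convex_set b) & basis F.
Proof.
exists [set o | open o /\ convex_set o]; first by move=> b /set_mem[].
split; first by move=> o [].
move=> x U /nbhsB[b Bb bU].
pose A := [set y | b (y - x)].
exists A°.
  split; last first.
    by rewrite /interior; apply/nbhsB; exists b.
  split; first exact: open_interior.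
  apply/convex_setP => y z t t0 t1 Ay Az.
  have cA : forall y z, A y -> A z -> A (t *: y + (1 - t) *: z).
    move=> {y z Ay Az} y z Ay Az.
    have /convex_setP/(_ _ _ t t0 t1 Ay Az) := (acB Bb).1.
    rewrite /A /= !scalerBr addrACA -opprD -scalerDl.
    by rewrite (addrC t) subrK scale1r.
  move: t0; rewrite le_eqVlt => /predU1P[<-|t0].
    by rewrite scale0r add0r subr0 scale1r.
  move: Ay => /nbhsB[c Bc cA1].
  have ti : 0 < t^-1 by rewrite invr_gt0.
  have [c' Bc' c'c] := scB Bc ti.
  apply/nbhsB; exists c' => // w c'w.
  rewrite (_ : w = t *: (y + t^-1 *: (w - (t *: y + (1 - t) *: z))) +
     (1 - t) *: z).
    apply: cA; last exact: nbhs_singleton.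
    by apply: cA1; rewrite addrC addKr; exact: c'c.
  rewrite scalerDr scalerA divff ?gt_eqF// scale1r.
  by rewrite addrAC addrC subrK.
by move=> y /nbhs_singleton; exact: bU.
Qed.

End disk_topology.

(* The topology of [finest_lcs V] has all absolutely convex absorbing subsets
   of [V] as a base of neighborhoods of 0. *)
Definition finest_lcs {R : realType} (V : lmodType R) : Type := V.

Section finest_lcs.
Context {R : realType} {V : lmodType R}.
Local Notation E := (finest_lcs V).

Definition disk : set (set V) :=
  [set A | absolutely_convex A /\ absorbing A].

Definition finest_nbhs (x : E) : set_system E :=
  [set U | exists2 A, disk A & forall y : V, A (y - (x : V)) -> U y].

Lemma disk0 A : disk A -> A 0.
Proof.
by move=> [_ /(_ 0)[d d0 /(_ 0)]]; rewrite scaler0; apply; rewrite normr0.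
Qed.

Lemma disk_scale A (r : R) : disk A -> 0 < r ->
  exists2 C, disk C & forall y, C y -> A (r *: y).
Proof.
move=> [[cA bA] aA] r0; exists [set y | A (r *: y)] => //.
split; [split|].
- apply/convex_setP => x y t t0 t1 /= Ax Ay.
  have /convex_setP/(_ _ _ t t0 t1 Ax Ay) := cA.
  by rewrite scalerDr !scalerA ![r * _]mulrC.
- by move=> t x t1 /= Ax; rewrite scalerA mulrC -scalerA; exact: bA.
- move=> x; have [d d0 dA] := aA (r *: x); exists d => // t /dA /=.
  by rewrite !scalerA mulrC.
Qed.

Lemma diskI A C : disk A -> disk C -> disk (A `&` C).
Proof.
move=> [[cA bA] aA] [[cC bC] aC]; split; [split|].
- apply/convex_setP => x y t t0 t1 [Ax Cx] [Ay Cy]; split.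
    by move/convex_setP : cA; apply.
  by move/convex_setP : cC; apply.
- by move=> t x t1 [Ax Cx]; split; [exact: bA|exact: bC].
- move=> x; have [d d0 dA] := aA x; have [e e0 eC] := aC x.
  exists (Num.min d e); first by rewrite lt_min d0.
  by move=> t; rewrite lt_min => /andP[/dA ? /eC].
Qed.

Lemma diskT : disk setT.
Proof. by split; [split|move=> x; exists 1] => //; apply/convex_setP. Qed.

Lemma finest_nbhs_filter (x : E) : ProperFilter (finest_nbhs x).
Proof.
split; first by move=> [A /disk0 A0] /(_ x); rewrite subrr; exact.
split; first by exists setT => //; exact: diskT.
- move=> P Q [A dA AP] [C dC CQ]; exists (A `&` C); first exact: diskI.
  by move=> y [/AP ? /CQ].
- by move=> P Q PQ [A dA AP]; exists A => // y /AP /PQ.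
Qed.

Lemma finest_nbhs_singleton (x : E) (U : set E) : finest_nbhs x U -> U x.
Proof. by move=> [A /disk0 A0]; apply; rewrite subrr. Qed.

Lemma finest_nbhs_nbhs (x : E) (U : set E) :
  finest_nbhs x U -> finest_nbhs x (finest_nbhs^~ U).
Proof.
move=> [A dA AU]; have [C dC CA] := disk_scale dA (ltr0n R 2).
exists C => // y Cy; exists C => // z Cz; apply: AU.
have /convex_setP/(_ _ _ (2^-1 : R) _ _ (CA _ Cz) (CA _ Cy)) := dA.1.1.
rewrite !scalerA mulVf// scale1r.
have -> : (1 - 2^-1) * 2 = 1 :> R.
  by rewrite mulrBl mul1r mulVf//; exact: (addrK 1 1).
rewrite scale1r addrA subrK; apply; first by rewrite invr_ge0.
by rewrite invf_le1// ler1n.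
Qed.

HB.instance Definition _ := GRing.Lmodule.on E.
HB.instance Definition _ := hasNbhs.Build E finest_nbhs.
HB.instance Definition _ := Nbhs_isNbhsTopological.Build E
  finest_nbhs_filter finest_nbhs_singleton finest_nbhs_nbhs.

Let finest_nbhsP (x : E) (U : set E) :
  nbhs x U <-> exists2 b, disk b & forall y, b (y - x) -> U y.
Proof. by []. Qed.

Let disk_ac A : disk A -> absolutely_convex A. Proof. by case. Qed.
Let disk_absorbing A : disk A -> absorbing A. Proof. by case. Qed.

Let finest_add_continuous : continuous (fun x : E * E => x.1 + x.2).
Proof. exact: disk_add_continuous finest_nbhsP disk_ac disk_scale. Qed.

Let finest_scale_continuous : continuous (fun z : R^o * E => z.1 *: z.2).
Proof. exact: disk_scale_continuous finest_nbhsP disk_ac disk_absorbing disk_scale. Qed.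

Let finest_locally_convex :
  exists2 B : set_system E, (forall b, b \in B -> convex_set b) & basis B.
Proof. exact: disk_locally_convex finest_nbhsP disk_ac disk_scale. Qed.

(* [PreTopologicalLmod_isTvs] only provides the uniform structure. *)
HB.instance Definition _ :=
  PreTopologicalNmodule_isTopologicalNmodule.Build E finest_add_continuous.
HB.instance Definition _ :=
  TopologicalNmodule_isTopologicalLmodule.Build R E finest_scale_continuous.
HB.instance Definition _ := PreTopologicalLmod_isTvs.Build R E
  finest_add_continuous finest_scale_continuous finest_locally_convex.
HB.instance Definition _ := Uniform_isTvs.Build R E finest_locally_convex.

End finest_lcs.

(* Every linear map from [finest_lcs V] to an lcs is continuous; with the
   identity of [V], no locally convex topology on [V] is strictly finer. *)
Lemma finest_lcs_continuous (R : realType) (V : lmodType R) (F : tvsType R)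
  (f : {linear V -> F}) : continuous (f : finest_lcs V -> F).
Proof.
have [B cB [oB bB]] := @locally_convex R F.
move=> x U fU.
have /bB[b [Bb b0 bU]] : nbhs (0 : F) [set y | U (y + f x)].
  have /= := @add_continuous F (0, f x) U; rewrite add0r => /(_ fU).
  move=> [[P Q] /= [P0 Qx] PQ]; apply: filterS P0 => y Py.
  by apply: (PQ (y, f x)); split => //; exact: nbhs_singleton.
exists [set y : V | b (f y) /\ b (- f y)]; last first.
  by move=> y [+ _]; rewrite raddfB => /bU /=; rewrite subrK.
have cb : forall (y z : F) (t : R), 0 <= t -> t <= 1 -> b y -> b z ->
    b (t *: y + (1 - t) *: z).
  by apply/(@convex_setP R F b); apply: cB; exact/mem_set.
split; [split|].
- apply/convex_setP => y z t t0 t1 [by1 by2] [bz1 bz2] /=.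
  rewrite linearD !linearZ_LR; split; first exact: cb.
  by rewrite opprD -!scalerN; exact: cb.
- have H : forall (t : R) y, 0 <= t -> t <= 1 -> b y -> b (t *: y).
    by move=> t y t0 t1 /cb => /(_ _ _ t0 t1 b0); rewrite scaler0 addr0.
  move=> t y; rewrite ler_norml => /andP[tN1 t1] [by1 by2] /=.
  rewrite linearZ_LR; have [t0|/ltW t0] := leP 0 t.
    by rewrite -scalerN; split; exact: H.
  have t0' : 0 <= - t by rewrite oppr_ge0.
  have t1' : - t <= 1 by rewrite lerNl.
  split; last by rewrite -scaleNr; exact: H.
  by rewrite -[t *: f y]opprK -scaleNr -scalerN; exact: H.
- have nb : nbhs (0 : F) b by apply: open_nbhs_nbhs; split => //; exact: oB.
  move=> y; have /= := @scale_continuous R F (0, f y) b.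
  rewrite scale0r => /(_ nb)[[P Q] /= [[e /= e0 eP] /nbhs_singleton Qy] PQ].
  exists e => // t te; rewrite linearZ_LR -scaleNr /=.
  by split; apply: (PQ (_, f y)); split => //; apply: eP;
    rewrite /= sub0r normrN ?normrN.
Qed.

(* {poly R} serves as a vector space of dimension aleph_0: the monomials form
   a Hamel basis. *)
Definition phi (R : realType) := finest_lcs {poly R}.
HB.instance Definition _ (R : realType) := Tvs.copy (phi R) (finest_lcs {poly R}).

(* For X = Q take rat^o: its topology is that of the distance |x - y|. *)
Definition Ck (R : realType) (X : topologicalType) : Type :=
  continuousType X R^o.

Section Ck.
Context {R : realType} {X : topologicalType}.
Local Notation C := (Ck R X).

HB.instance Definition _ := Choice.on C.

Definition Ck_fun (f : C) : X -> R := f.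

Coercion Ck_fun : Ck >-> Funclass.

Lemma Ck_eqP (f g : C) : Ck_fun f =1 Ck_fun g -> f = g.
Proof. by move=> fg; apply/continuousEP. Qed.

Lemma Ck_continuous (f : C) : continuous (f : X -> R^o).
Proof. exact: (@cts_fun _ _ f). Qed.

Definition mkCk (f : X -> R^o) (cf : continuous f) : C :=
  (mkcts cf : continuousType X R^o).

Let cst0 : continuous (fun _ : X => 0 : R^o).
Proof. by move=> x; exact: cvg_cst. Qed.
Let oppC (f : C) : continuous (fun x => - f x : R^o).
Proof. by move=> x; apply: cvgN; exact: Ck_continuous. Qed.
Let addC (f g : C) : continuous (fun x => f x + g x : R^o).
Proof. by move=> x; apply: cvgD; exact: Ck_continuous. Qed.
Let scaleC (a : R) (f : C) : continuous (fun x => a * f x : R^o).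
Proof. by move=> x; apply: cvgM; [exact: cvg_cst|exact: Ck_continuous]. Qed.

Definition Ck_zero : C := mkCk cst0.
Definition Ck_opp (f : C) : C := mkCk (@oppC f).
Definition Ck_add (f g : C) : C := mkCk (@addC f g).
Definition Ck_scale (a : R) (f : C) : C := mkCk (@scaleC a f).

Let Ck_addA : associative Ck_add.
Proof. by move=> f g h; apply: Ck_eqP => x; exact: addrA. Qed.
Let Ck_addC : commutative Ck_add.
Proof. by move=> f g; apply: Ck_eqP => x; exact: addrC. Qed.
Let Ck_add0 : left_id Ck_zero Ck_add.
Proof. by move=> f; apply: Ck_eqP => x; exact: add0r. Qed.
Let Ck_addN : left_inverse Ck_zero Ck_opp Ck_add.
Proof. by move=> f; apply: Ck_eqP => x; exact: addNr. Qed.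

HB.instance Definition _ :=
  GRing.isZmodule.Build C Ck_addA Ck_addC Ck_add0 Ck_addN.

Let Ck_scaleA a b (f : C) : Ck_scale a (Ck_scale b f) = Ck_scale (a * b) f.
Proof. by apply: Ck_eqP => x; exact: mulrA. Qed.
Let Ck_scale1 : left_id 1 Ck_scale.
Proof. by move=> f; apply: Ck_eqP => x; exact: mul1r. Qed.
Let Ck_scaleDr : right_distributive Ck_scale +%R.
Proof. by move=> a f g; apply: Ck_eqP => x; exact: mulrDr. Qed.
Let Ck_scaleDl (f : C) : {morph Ck_scale^~ f : a b / a + b}.
Proof. by move=> a b; apply: Ck_eqP => x; exact: mulrDl. Qed.

HB.instance Definition _ := GRing.Zmodule_isLmodule.Build R C
  Ck_scaleA Ck_scale1 Ck_scaleDr Ck_scaleDl.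

HB.instance Definition _ := Topological.copy C
  (initial_topology (Ck_fun : C -> {compact-open, X -> R^o})).

Definition Ck_disk : set (set C) := [set b | exists K (e : R),
  [/\ compact K, 0 < e & b = [set g : C | forall x, K x -> `|g x| < e]]].

Lemma Ck_nbhsP (f : C) (U : set C) :
  nbhs f U <-> exists2 b, Ck_disk b & forall g, b (g - f) -> U g.
Proof.
have cf := @Ck_continuous f.
split.
  move=> [_ [[W oW <-] /= Wf WU]].
  pose F : set_system (X -> R^o) := [set P | exists K (e : R), [/\ compact K, 0 < e &
    [set g | forall x, K x -> `|g x - f x| < e] `<=` P]].
  have FF : Filter F.
    split.
    - by exists set0, 1; split => //; exact: compact0.
    - move=> P Q [K [e [cK e0 KP]]] [L [d [cL d0 LQ]]].
      exists (K `|` L), (Num.min e d); split.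
      + exact: compactU.
      + by rewrite lt_min e0.
      + move=> g gKL; split.
          by apply: KP => x Kx; have := gKL x (or_introl Kx); rewrite lt_min => /andP[].
        by apply: LQ => x Lx; have := gKL x (or_intror Lx); rewrite lt_min => /andP[].
    - move=> P Q PQ [K [e [cK e0 KP]]]; exists K, e; split => //.
      exact: subset_trans PQ.
  have : {compact-open, F --> (f : X -> R^o)}.
    apply/(compact_open_fam_compactP cf FF)/fam_cvgP => K cK P.
    move=> /uniform_nbhs[V [entV VP]].
    move: entV; rewrite -entourage_ballE => -[e /= e0 eV].
    exists K, e; split => // g gK; apply: VP => x Kx; apply: eV.
    by rewrite /= /ball /= distrC; exact: gK.
  move=> /(_ W)/(_ (open_nbhs_nbhs (conj oW Wf)))[K [e [cK e0 KW]]].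
  exists [set g : C | forall x, K x -> `|g x| < e]; first by exists K, e.
  by move=> g gK; apply: WU; apply: KW.
move=> [_ [K [e [cK e0 ->]]] bU].
have cvgf : {family compact, nbhs (f : {compact-open, X -> R^o}) -->
    (f : X -> R^o)}.
  by apply/compact_open_fam_compactP => //; exact: cvg_id.
have FF : Filter (nbhs (f : {compact-open, X -> R^o})) by exact: nbhs_filter.
have ucvgf := (@fam_cvgP X R^o compact _ (f : X -> R^o) FF).1 cvgf K cK.
have [] : nbhs (f : {compact-open, X -> R^o})
    [set g : X -> R^o | forall x, K x -> `|g x - f x| < e].
  apply: ucvgf.
  apply/uniform_nbhs; exists [set xy | ball xy.1 e xy.2]; split.
    by rewrite -entourage_ballE; exists e.
  by move=> g gK x /gK; rewrite /ball /= distrC.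
move=> W [oW Wf WK].
have : nbhs f (Ck_fun @^-1` W : set C).
  exists (Ck_fun @^-1` W); split => //.
  by exists W.
by apply: filterS => g Wg; apply: bU => x Kx; exact: WK.
Qed.

Let Ck_disk_ac b : Ck_disk b -> absolutely_convex b.
Proof.
move=> [K [e [cK e0 ->]]]; split.
  apply/convex_setP => f g t t0 t1 fK gK x Kx.
  rewrite [X in `|X|](_ : _ = t * f x + (1 - t) * g x)//.
  rewrite (le_lt_trans (ler_normD _ _))// !normrM (ger0_norm t0).
  rewrite (@ger0_norm _ (1 - t)) ?subr_ge0//.
  move: t0; rewrite le_eqVlt => /predU1P[<-|t0].
    by rewrite mul0r add0r subr0 mul1r; exact: gK.
  rewrite [ltRHS](_ : _ = t * e + (1 - t) * e); last first.
    by rewrite -mulrDl addrC subrK mul1r.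
  apply: ltr_leD; first by rewrite ltr_pM2l//; exact: fK.
  by rewrite ler_wpM2l ?subr_ge0// ltW//; exact: gK.
move=> t f t1 fK x Kx.
rewrite [X in `|X|](_ : _ = t * f x)//.
rewrite normrM (le_lt_trans _ (fK x Kx))//.
by rewrite ler_piMl.
Qed.

Let Ck_disk_absorbing b : Ck_disk b -> absorbing b.
Proof.
move=> [K [e [cK e0 ->]]] f.
have /compact_bounded : compact (f @` K : set R^o).
  apply: continuous_compact => //; apply: continuous_subspaceT.
  exact: Ck_continuous.
move=> [M [Mr MK]].
have M1 : 0 < `|M| + 1 by rewrite ltr_wpDl.
exists (e / (`|M| + 1)); first by rewrite divr_gt0.
move=> t te x Kx.
rewrite [X in `|X|](_ : _ = t * f x)//.
have fM : `|f x| <= `|M| + 1.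
  apply: (MK (`|M| + 1)); last by exists x.
  by rewrite (le_lt_trans (ler_norm M))// ltrDl.
rewrite normrM (le_lt_trans (ler_wpM2l _ fM))//.
by rewrite -ltr_pdivlMr.
Qed.

Let Ck_disk_scale b (r : R) : Ck_disk b -> 0 < r ->
  exists2 c, Ck_disk c & forall y, c y -> b (r *: y).
Proof.
move=> [K [e [cK e0 ->]]] r0.
exists [set g : C | forall x, K x -> `|g x| < e / r].
  by exists K, (e / r); split => //; rewrite divr_gt0.
move=> f fK x Kx.
rewrite [X in `|X|](_ : _ = r * f x)//.
by rewrite normrM (gtr0_norm r0) mulrC -ltr_pdivlMr//; exact: fK.
Qed.

Let Ck_add_continuous : continuous (fun x : C * C => x.1 + x.2).
Proof. exact: disk_add_continuous Ck_nbhsP Ck_disk_ac Ck_disk_scale. Qed.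

Let Ck_scale_continuous : continuous (fun z : R^o * C => z.1 *: z.2).
Proof. exact: disk_scale_continuous Ck_nbhsP Ck_disk_ac Ck_disk_absorbing Ck_disk_scale. Qed.

Let Ck_locally_convex :
  exists2 B : set_system C, (forall b, b \in B -> convex_set b) & basis B.
Proof. exact: disk_locally_convex Ck_nbhsP Ck_disk_ac Ck_disk_scale. Qed.

HB.instance Definition _ :=
  PreTopologicalNmodule_isTopologicalNmodule.Build C Ck_add_continuous.
HB.instance Definition _ :=
  TopologicalNmodule_isTopologicalLmodule.Build R C Ck_scale_continuous.
HB.instance Definition _ := PreTopologicalLmod_isTvs.Build R C
  Ck_add_continuous Ck_scale_continuous Ck_locally_convex.
HB.instance Definition _ := Uniform_isTvs.Build R C Ck_locally_convex.

End Ck.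

(* A vector subspace is a [submodClosed] predicate; [sub_lcs W] is W as a space
   of its own, with the induced topology. *)
Definition sub_lcs {R : realType} {E : tvsType R} (W : submodClosed E) : Type :=
  {x : E | x \in W}.

Section sub_lcs.
Context {R : realType} {E : tvsType R} (W : submodClosed E).
Local Notation S := (sub_lcs W).

HB.instance Definition _ := SubChoice.on S.
HB.instance Definition _ := [SubChoice_isSubLmodule of S by <:].
HB.instance Definition _ := Topological.copy S
  (initial_topology (val : S -> E)).

Let sub_add_continuous : continuous (fun x : S * S => x.1 + x.2).
Proof.
apply: (@continuous_comp_initial S _ E val) => -[x y].
rewrite (_ : _ \o _ = (fun u : S * S => val u.1 + val u.2)); last first.
  by apply/funext => -[u v]; exact: raddfD.
apply: (@continuous2_cvg _ E E E _ _ (fun u : S * S => val u.1)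
  (fun u : S * S => val u.2) (fun a b => a + b) (val x) (val y)).
- exact: (@add_continuous E (val x, val y)).
- by apply: (cvg_comp _ _ cvg_fst); exact: (@initial_continuous S E val).
- by apply: (cvg_comp _ _ cvg_snd); exact: (@initial_continuous S E val).
Qed.

Let sub_scale_continuous : continuous (fun z : R^o * S => z.1 *: z.2).
Proof.
apply: (@continuous_comp_initial S _ E val) => -[r y].
rewrite (_ : _ \o _ = (fun u : R^o * S => u.1 *: val u.2)); last first.
  by apply/funext => -[u v]; exact: linearZ.
apply: (@continuous2_cvg _ R^o E E _ _ (fun u : R^o * S => u.1)
  (fun u : R^o * S => val u.2) (fun a b => a *: b) r (val y)).
- exact: (@scale_continuous R E (r, val y)).
- exact: cvg_fst.
- by apply: (cvg_comp _ _ cvg_snd); exact: (@initial_continuous S E val).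
Qed.

Let sub_locally_convex :
  exists2 B : set_system S, (forall b, b \in B -> convex_set b) & basis B.
Proof.
have [B cB [oB bB]] := @locally_convex R E.
exists [set val @^-1` b | b in B].
  move=> _ /set_mem[b Bb <-]; apply/convex_setP => x y t t0 t1 bx by_.
  have valE : val (t *: x + (1 - t) *: y : S) = t *: val x + (1 - t) *: val y.
    by rewrite raddfD; congr (_ + _); exact: linearZ.
  have /convex_setP cb : convex_set b by apply: cB; exact/mem_set.
  by rewrite /preimage /mkset; move: (cb _ _ _ t0 t1 bx by_); rewrite -valE.
split; first by move=> _ [b Bb <-]; exists b => //; exact: oB.
move=> x U [_ [[V oV <-] /= Vx VU]].
have [b [Bb bx bV]] := bB _ _ (open_nbhs_nbhs (conj oV Vx)).
exists (val @^-1` b); first by split => //; exists b.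
by move=> y /bV; exact: VU.
Qed.

HB.instance Definition _ :=
  PreTopologicalNmodule_isTopologicalNmodule.Build S sub_add_continuous.
HB.instance Definition _ :=
  TopologicalNmodule_isTopologicalLmodule.Build R S sub_scale_continuous.
HB.instance Definition _ := PreTopologicalLmod_isTvs.Build R S
  sub_add_continuous sub_scale_continuous sub_locally_convex.
HB.instance Definition _ := Uniform_isTvs.Build R S sub_locally_convex.

End sub_lcs.

Section copies.
Context {R : realType}.

Definition linearly_homeomorphic (E F : tvsType R) :=
  exists (f : {linear E -> F}) (g : F -> E),
    [/\ cancel f g, cancel g f, continuous f & continuous g].

Definition copy_of_phi {E : tvsType R} (W : submodClosed E) :=
  linearly_homeomorphic (phi R) (sub_lcs W).

Definition complemented {E : tvsType R} (W : submodClosed E) :=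
  exists P : {linear E -> E},
    [/\ continuous P, P \o P =1 P & range P = [set` W]].

End copies.

Section differentiability.
Context {R : realType} {E : tvsType R}.
Implicit Types (f : E -> R^o) (D : set E) (x : E).

Definition gateaux_derivative f x (df : {linear E -> R^o}) :=
  continuous df /\
  forall y, t^-1 *: (f (x + t *: y) - f x) @[t --> (0 : R)^'] --> df y.

Definition gateaux_differentiable f x :=
  exists df : {linear E -> R^o}, gateaux_derivative f x df.

Definition tvs_bounded (B : set E) :=
  forall U, nbhs (0 : E) U -> \forall r \near +oo_R, B `<=` [set r *: u | u in U].

Definition frechet_differentiable f x :=
  exists df : {linear E -> R^o}, gateaux_derivative f x df /\
    forall B, tvs_bounded B -> forall e : R, 0 < e ->
      \forall t \near (0 : R)^', forall y, B y ->
        `|t^-1 *: (f (x + t *: y) - f x) - df y| < e.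

(* A function on D is represented by a function on E whose values outside D are
   irrelevant: D is open, so only values on D matter in the limits above. *)
Definition continuous_convex_on D f :=
  [/\ D !=set0, open D, convex_set D, {within D, continuous f} &
      convex_function D f].

End differentiability.

Definition Asplund {R : realType} (E : tvsType R) :=
  forall (D : set E) (f : E -> R^o), continuous_convex_on D f ->
    exists G : set E, [/\ Gdelta G, G `<=` D, D `<=` closure G &
      forall x, G x -> frechet_differentiable f x].

Definition GDS {R : realType} (E : tvsType R) :=
  forall (D : set E) (f : E -> R^o), continuous_convex_on D f ->
    exists G : set E, [/\ G `<=` D, D `<=` closure G &
      forall x, G x -> gateaux_differentiable f x].

(* Main.v *)
(** The function f(p) = sum of the |p_i| is convex and continuous on phi, and it
    is nowhere Gateaux differentiable: at p it has a corner in the direction of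
    every monomial X^n with n >= size p.  So phi is not a GDS, and composing f
    with a projection onto a complemented copy of phi would contradict the
    Asplund property.

    A closed copy of phi in C_k(Q) is spanned by continuous functions F_n with
    disjoint supports shrinking to 0, each F_n being unbounded: compact sets
    {0} U {q_n} with |F_n(q_n)| arbitrarily large show that the induced topology
    is the finest one, and a limit of elements of the span, being continuous at
    0, has finitely many nonzero coordinates.

    C_k(Q) is Asplund because the compact subsets of Q are countable.  Near a
    point a continuous convex f depends only on the values on a compact set K
    and is Lipschitz for the sup norm.  A Baire argument for that norm gives
    points near which, for every k in Q, the slopes of f in the directions
    supported by a small clopen A_k around k depend, up to 2^-(i_k + j), only on
    the value of the direction at k (i_k enumerates Q).  Finitely many A_k cover
    K, so that the slopes of f in any fixed direction of norm at most 1 are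
    nearly constant near such a point, which is Frechet differentiability. *)
From HB Require Import structures.
Require Import Defs.
From mathcomp Require Import all_boot all_order all_algebra.
From mathcomp Require Import interval_inference.
From mathcomp Require Import all_classical all_reals all_analysis.
From mathcomp Require Import ring lra.

Set Implicit Arguments.
Unset Strict Implicit.
Unset Printing Implicit Defensive.

Import Order.TTheory GRing.Theory Num.Theory.
Import numFieldNormedType.Exports.

Local Open Scope classical_set_scope.
Local Open Scope ring_scope.

(** * Convexity inequalities with real weights *)

Section convex_functions.
Context {R : realType} {V : lmodType R}.
Implicit Types (D : set V) (f : V -> R^o).

Lemma convex_functionP D f : convex_function D f <->
  (forall x y (t : R), 0 <= t -> t <= 1 -> D x -> D y ->
     f (t *: x + (1 - t) *: y) <= t * f x + (1 - t) * f y).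
Proof.
split=> [cf x y t t0 t1 Dx Dy|cf t x y /set_mem Dx /set_mem Dy]; last first.
  exact: cf.
have t01 : (Itv.spec (Itv.num_sem (R := R)) (Itv.Real `[0, 1]%Z) t).
  by rewrite /= /Itv.num_sem /= in_itv /= t0 t1 (ger0_real t0).
exact: (cf (Itv.mk t01) x y (mem_set Dx) (mem_set Dy)).
Qed.

(** Three-slope inequality with the denominators cleared: the middle point has weight t / (t + s) on
    the far end. *)
Lemma convex_slopes D f y h (t s : R) : convex_function D f ->
  0 < t -> 0 < s -> D y -> D (y + t *: h + s *: h) ->
  s * (f (y + t *: h) - f y) <= t * (f (y + t *: h + s *: h) - f (y + t *: h)).
Proof.
move=> /convex_functionP cf t0 s0 Dy Dz.
have ts0 : 0 < t + s by exact: addr_gt0.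
have ts_neq0 : t + s != 0 by rewrite gt_eqF.
have := cf _ _ (t / (t + s)) _ _ Dz Dy.
have E1 : 1 - t / (t + s) = s / (t + s) by field.
have -> : t / (t + s) *: (y + t *: h + s *: h) + (1 - t / (t + s)) *: y =
    y + t *: h.
  by rewrite -addrA -scalerDl scalerDr addrAC -scalerDl subrKC scale1r scalerA divfK.
have a0 : 0 <= t / (t + s) by rewrite divr_ge0 ?ltW.
have a1 : t / (t + s) <= 1 by rewrite ler_pdivrMr// mul1r lerDl ltW.
rewrite E1 => /(_ a0 a1) H.
have : (t + s) * f (y + t *: h) <= t * f (y + t *: h + s *: h) + s * f y.
  have := ler_wpM2l (ltW ts0) H.
  by rewrite mulrDr ![_ * (_ / _ * _)]mulrCA !mulrA !divfK// mulrC.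
lra.
Qed.

End convex_functions.

(** * Slopes of convex functions along sup-norm open sets *)

Section sup_norm.
Context {R : realType} {X : topologicalType}.
Local Notation C := (Ck R X).
Implicit Types (g h y : C) (V W D : set C).

Lemma CkDE g h x : Ck_fun (g + h) x = g x + h x. Proof. by []. Qed.
Lemma CkNE g x : Ck_fun (- g) x = - g x. Proof. by []. Qed.
Lemma CkBE g h x : Ck_fun (g - h) x = g x - h x. Proof. by []. Qed.
Lemma CkZE (a : R) g x : Ck_fun (a *: g) x = a * g x. Proof. by []. Qed.
Lemma Ck0E x : Ck_fun (0 : C) x = 0. Proof. by []. Qed.
Definition CkE := (CkBE, CkDE, CkNE, CkZE, Ck0E).

Definition sup_le h (r : R) := forall x, `|h x| <= r.

(** Openness for the extended sup distance, finer than the topology of [C]. Members of [C] may be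
    unbounded, so only bounded directions can be scaled continuously; hence the [sup_le] hypotheses
    below. *)
Definition sup_open V :=
  forall y, V y -> exists2 r : R, 0 < r & forall h, sup_le h r -> V (y + h).

Lemma sup_le0 (r : R) : 0 <= r -> sup_le 0 r.
Proof. by move=> r0 x; rewrite CkE normr0. Qed.

Lemma sup_leW h (r s : R) : r <= s -> sup_le h r -> sup_le h s.
Proof. by move=> rs hr x; exact: le_trans rs. Qed.

Lemma sup_leN h (r : R) : sup_le h r -> sup_le (- h) r.
Proof. by move=> hr x; rewrite CkE normrN. Qed.

Lemma sup_leD g h (r s : R) : sup_le g r -> sup_le h s -> sup_le (g + h) (r + s).
Proof. by move=> gr hs x; rewrite CkE (le_trans (ler_normD _ _))// lerD. Qed.

Lemma sup_leZ h (a r : R) : sup_le h r -> sup_le (a *: h) (`|a| * r).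
Proof. by move=> hr x; rewrite CkE normrM ler_wpM2l. Qed.

Lemma sup_openI V W : sup_open V -> sup_open W -> sup_open (V `&` W).
Proof.
move=> oV oW y [/oV[r r0 rV] /oW[s s0 sW]].
exists (Num.min r s) => [|h hrs]; first by rewrite lt_min r0.
by split; [apply: rV|apply: sW]; apply: sup_leW hrs; rewrite ge_min lexx ?orbT.
Qed.

Lemma sup_open_segment V y h (c : R) : sup_open V -> V y -> sup_le h c ->
  exists2 s : R, 0 < s & forall t : R, `|t| <= s -> V (y + t *: h).
Proof.
move=> oV /oV[r r0 rV] hc.
(* The bound c can be zero, or negative when X is empty; |c| + 1 is always positive. *)
have c0 : 0 < `|c| + 1 by rewrite ltr_wpDl.
exists (r / (`|c| + 1)) => [|t ts]; first by rewrite divr_gt0.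
apply: rV => x; rewrite CkE normrM.
have hx : `|h x| <= `|c| + 1.
  by rewrite (le_trans (hc x))// (le_trans (ler_norm _))// lerDl.
by rewrite (le_trans (ler_pM _ _ ts hx))// divfK// gt_eqF.
Qed.

End sup_norm.

Section slopes.
Context {R : realType} {X : topologicalType}.
Local Notation C := (Ck R X).
Variables (f : C -> R^o).
Implicit Types (g h y z : C) (V W D : set C) (a b t s : R).

(** Only forward increments with both ends in [V] are bounded. A lower bound b for the slopes along
    h reads [slope_le V (- h) (- b)]. *)
Definition slope_le V h a := forall y t,
  0 < t -> V y -> V (y + t *: h) -> f (y + t *: h) - f y <= a * t.

Lemma slope_leS V W h a : W `<=` V -> slope_le V h a -> slope_le W h a.
Proof. by move=> WV s y t t0 /WV ? /WV; exact: s. Qed.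

Lemma slope_leW V h a b : a <= b -> slope_le V h a -> slope_le V h b.
Proof.
by move=> ab s y t t0 Vy Vyt; rewrite (le_trans (s y t t0 Vy Vyt))// ler_pM2r.
Qed.

Lemma slope_leZ V h a b : 0 <= b -> slope_le V h a -> slope_le V (b *: h) (b * a).
Proof.
rewrite le_eqVlt => /predU1P[<-|b0] s y t t0 Vy.
  by rewrite scale0r scaler0 addr0 !mul0r subrr.
rewrite scalerA => Vyt.
have := s y (t * b) (mulr_gt0 t0 b0) Vy Vyt.
by rewrite [b * a]mulrC -mulrA [b * t]mulrC.
Qed.

Section convex.
Variables (D : set C).
Hypothesis convf : convex_function D f.

(** The point [y + t *: g] may lie outside [V], so the sum is not split there. By convexity the
    slope up to [w] is at most that over a short segment beyond [w], which can be split inside the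
    open set [V]. *)
Lemma slope_leD V g h a b (c d : R) : V `<=` D -> sup_open V ->
  sup_le g c -> sup_le h d ->
  slope_le V g a -> slope_le V h b -> slope_le V (g + h) (a + b).
Proof.
move=> VD oV gc hd sg sh y t t0 Vy Vw; set w := y + t *: (g + h) in Vw *.
have [s1 s10 Vg] := sup_open_segment oV Vw gc.
have [s2 s20 Vgh] := sup_open_segment oV Vw (sup_leD gc hd).
pose s := Num.min s1 s2.
have s0 : 0 < s by rewrite lt_min s10.
have sn : `|s| = s by rewrite gtr0_norm.
have Vsg : V (w + s *: g) by apply: Vg; rewrite sn ge_min lexx.
have Vsgh : V (w + s *: (g + h)) by apply: Vgh; rewrite sn ge_min lexx orbT.
have Vsgh' : V (w + s *: g + s *: h) by rewrite -addrA -scalerDr.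
have H1 := convex_slopes convf t0 s0 (VD _ Vy) (VD _ Vsgh).
have H2 := sg _ _ s0 Vw Vsg; have H3 := sh _ _ s0 Vsg Vsgh'.
rewrite -/w scalerDr addrA in H1.
rewrite -(ler_pM2l s0) (le_trans H1)//.
rewrite [leRHS](_ : _ = t * (a * s + b * s)); last by ring.
by rewrite ler_pM2l//; lra.
Qed.

Lemma slope_le_ge V h a b (c : R) : V !=set0 -> sup_open V -> sup_le h c ->
  slope_le V h a -> slope_le V (- h) (- b) -> b <= a.
Proof.
move=> [y Vy] oV hc sa sb.
have [s s0 Vh] := sup_open_segment oV Vy hc.
have Vw : V (y + s *: h) by apply: Vh; rewrite gtr0_norm.
have yE : y + s *: h + s *: - h = y by rewrite scalerN addrK.
have H1 := sa _ _ s0 Vy Vw; have := sb _ _ s0 Vw; rewrite yE => /(_ Vy) H2.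
by rewrite -(ler_pM2r s0); lra.
Qed.

Variable L : R.
Hypothesis lipf : forall y h r,
  D y -> D (y + h) -> sup_le h r -> f (y + h) - f y <= L * r.

Lemma lip_slope_le V h r : V `<=` D -> sup_le h r -> slope_le V h (L * r).
Proof.
move=> VD hr y t t0 Vy Vyt; rewrite -mulrA [r * t]mulrC.
by apply: lipf; [exact: VD..|]; rewrite -[X in X * r]gtr0_norm//; exact: sup_leZ.
Qed.

(* The reversed slopes are bounded near the far end of the steep segment
   because slopes of a convex function increase along a line. *)
Lemma steep_open V h a y t (c : R) : V `<=` D -> sup_open V -> sup_le h c ->
  0 < t -> V y -> V (y + t *: h) -> a * t < f (y + t *: h) - f y ->
  exists W, [/\ W `<=` V, W !=set0, sup_open W & slope_le W (- h) (- a)].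
Proof.
move=> VD oV hc t0 Vy Vyt sy.
exists [set w | [/\ V w, V (w - t *: h) & a * t < f w - f (w - t *: h)]].
split.
- by move=> w [].
- by exists (y + t *: h); rewrite /= addrK.
- move=> w [Vw Vwt sw].
  have [r1 r10 Vr1] := oV _ Vw; have [r2 r20 Vr2] := oV _ Vwt.
  have e0 : 0 < f w - f (w - t *: h) - a * t by rewrite subr_gt0.
  have L1 : 0 < 2 * `|L| + 1 by rewrite ltr_wpDl// mulr_ge0.
  (* Moving both ends by at most r lowers the increment by at most 2 |L| r; the extra 1 keeps it
     strictly above [a * t]. *)
  pose r := Num.min (Num.min r1 r2)
    ((f w - f (w - t *: h) - a * t) / (2 * `|L| + 1)).
  have r0 : 0 < r by rewrite !lt_min r10 r20 divr_gt0.
  have rr1 : r <= r1 by rewrite !ge_min lexx.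
  have rr2 : r <= r2 by rewrite !ge_min lexx ?orbT.
  have re : (2 * `|L| + 1) * r <= f w - f (w - t *: h) - a * t.
    by rewrite mulrC -ler_pdivlMr// ge_min lexx orbT.
  exists r => // g gr.
  have Vg1 := Vr1 _ (sup_leW rr1 gr); have Vg2 := Vr2 _ (sup_leW rr2 gr).
  have E : w + g - t *: h = w - t *: h + g by rewrite addrAC.
  split => //=; rewrite E//.
  have H1 := lipf (VD _ Vwt) (VD _ Vg2) gr.
  have H2 : f w - f (w + g) <= L * r.
    have := lipf (VD _ Vg1) (_ : D (w + g + - g)) (sup_leN gr).
    by rewrite addrK; apply; exact: VD.
  have H3 : L * r <= `|L| * r by rewrite ler_pM2r// ler_norm.
  lra.
- move=> z s s0 [Vz _ _]; rewrite scalerN => -[Vw Vwt].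
  set w := z - s *: h in Vw Vwt * => sw.
  have E1 : w - t *: h + t *: h = w by rewrite subrK.
  have E2 : w + s *: h = z by rewrite subrK.
  have := @convex_slopes _ _ D f (w - t *: h) h t s convf t0 s0 (VD _ Vwt).
  rewrite E1 E2 => /(_ (VD _ Vz)) H.
  rewrite -(ler_pM2l t0).
  have : s * (a * t) <= s * (f w - f (w - t *: h)) by rewrite ler_pM2l// ltW.
  nra.
Qed.

End convex.
End slopes.

(** * Cutting functions along clopen sets *)

Section clopen_restriction.
Context {R : realType} {X : topologicalType}.
Local Notation C := (Ck R X).
Implicit Types (A B : set X) (h : C).

Lemma clopen_indic_continuous A : clopen A -> continuous (\1_A : X -> R^o).
Proof.
move=> [oA cA] x; apply: cvg_near_cst.
have [Ax|nAx] := pselect (A x).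
  have : nbhs x A by apply: open_nbhs_nbhs.
  by apply: filterS => y Ay; rewrite !indicE !mem_set.
have : nbhs x (~` A) by apply: open_nbhs_nbhs; split => //; exact: closed_openC.
by apply: filterS => y Ay; rewrite !indicE !memNset.
Qed.

Definition Ck_one : C := mkCk (@cst_continuous X R^o 1).

Lemma clopen_restrict_continuous A h : clopen A ->
  continuous (fun x => \1_A x * h x : R^o).
Proof.
move=> cA x; apply: cvgM; first exact: clopen_indic_continuous.
exact: Ck_continuous.
Qed.

Definition restr A (cA : clopen A) h : C :=
  mkCk (@clopen_restrict_continuous A h cA).

Lemma restrE A (cA : clopen A) h x : restr cA h x = (x \in A)%:R * h x :> R.
Proof. by []. Qed.

Lemma restr_in A (cA : clopen A) h x : A x -> restr cA h x = h x.
Proof. by move=> Ax; rewrite restrE mem_set// mulr1n mul1r. Qed.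

Lemma restr_out A (cA : clopen A) h x : ~ A x -> restr cA h x = 0.
Proof. by move=> Ax; rewrite restrE memNset// mulr0n mul0r. Qed.

Lemma restrC A (cA : clopen A) (cB : clopen (~` A)) h :
  restr cA h + restr cB h = h.
Proof.
apply: Ck_eqP => x; rewrite CkE; have [Ax|nAx] := pselect (A x).
  by rewrite restr_in// restr_out ?addr0//; apply.
by rewrite restr_out// restr_in// add0r.
Qed.

Lemma sup_le_restr A (cA : clopen A) h (r : R) :
  0 <= r -> (forall x, A x -> `|h x| <= r) -> sup_le (restr cA h) r.
Proof.
move=> r0 hr x; have [Ax|nAx] := pselect (A x).
  by rewrite restr_in//; exact: hr.
by rewrite restr_out// normr0.
Qed.

End clopen_restriction.

Definition clopen_basis (X : topologicalType) := forall (x : X) (U : set X),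
  nbhs x U -> exists A, [/\ clopen A, A x & A `<=` U].

(** * Shrinking open sets to control slopes *)

Section refinement.
Context {R : realType} {X : topologicalType}.
Local Notation C := (Ck R X).
Variables (f : C -> R^o) (D : set C) (L : R).
Hypothesis Xbasis : clopen_basis X.
Hypothesis convf : convex_function D f.
Hypothesis lipf : forall (y h : C) (r : R),
  D y -> D (y + h) -> sup_le h r -> f (y + h) - f y <= L * r.
Implicit Types (h : C) (V W : set C) (a e : R).

Lemma steep_refine V h a (c : R) : V `<=` D -> sup_open V -> sup_le h c ->
  ~ slope_le f V h a ->
  exists W, [/\ W `<=` V, W !=set0, sup_open W & slope_le f W (- h) (- a)].
Proof.
move=> VD oV hc /existsNP[y] /existsNP[t].
move=> /not_implyP[t0] /not_implyP[Vy] /not_implyP[Vyt] /negP.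
rewrite -ltNge => sy.
exact: (steep_open convf lipf VD oV hc t0 Vy Vyt sy).
Qed.

(** Let m be the infimum of the slope bounds along h on [V]. Since m - e/2 is not a bound, [V]
    contains a steep segment, near whose far end the slopes stay between m - e/2 and m + e/2. *)
Lemma flat_refine V h e (c : R) : V `<=` D -> V !=set0 -> sup_open V ->
  sup_le h c -> 0 < e ->
  exists W a, [/\ W `<=` V, W !=set0, sup_open W &
    slope_le f W h a /\ slope_le f W (- h) (e - a)].
Proof.
move=> VD V0 oV hc e0.
pose S := [set a | slope_le f V h a].
have SLc : S (L * c) by exact: lip_slope_le lipf _ _ _ _ _.
have Slb : lbound S (- (L * c)).
  move=> a Sa; apply: (slope_le_ge V0 oV hc Sa); rewrite opprK.
  by apply: (lip_slope_le lipf) => //; exact: sup_leN.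
have Sinf : has_inf S by split; [exists (L * c)|exists (- (L * c))].
have e20 : 0 < e / 2 by rewrite divr_gt0.
have [a Sa ae] := inf_adherent e20 Sinf.
have [|W [WV W0 oW sW]] := @steep_refine V h (inf S - e / 2) c VD oV hc.
  move=> Se; have := ge_inf Sinf.2 Se.
  by rewrite leNgt gtrBl e20.
exists W, a; split => //; split; first exact: slope_leS Sa.
by apply: slope_leW sW; lra.
Qed.

(* Let nu be the infimum of the slope bounds valid on some part of V for all
   directions supported by some neighborhood of k.  After shrinking V and fixing
   a neighborhood A, the bounds stay close to nu under further shrinking; a
   steep direction h1 in A vanishing near k, added to a nearly optimal direction
   h2 supported where h1 vanishes, would exceed nu. *)
Lemma concentrate k V e : V `<=` D -> V !=set0 -> sup_open V -> 0 < e ->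
  exists W A, [/\ W `<=` V, W !=set0 /\ sup_open W, clopen A /\ A k &
    forall h, sup_le h 1 -> (forall x, ~ A x -> h x = 0) -> h k = 0 ->
      slope_le f W h e].
Proof.
move=> VD V0 oV e0.
pose S := [set a : R | exists W A, [/\ W `<=` V, W !=set0 /\ sup_open W,
  clopen A /\ A k & forall h, sup_le h 1 ->
    (forall x, ~ A x -> h x = 0) -> slope_le f W h a]].
have SL : S (L * 1).
  exists V, setT; split => //; first by split => //; exact: clopenT.
  by move=> h h1 _; exact: lip_slope_le lipf _ _ _ _ _.
have Slb : lbound S 0.
  move=> a [W [A [WV [W0 oW] _ Wa]]].
  have s0 : slope_le f W 0 a.
    by apply: Wa => [|x _]; [exact: sup_le0|exact: Ck0E].
  apply: (slope_le_ge W0 oW (sup_le0 (lexx 0)) s0).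
  by move=> y t _ _ _; rewrite !oppr0 scaler0 addr0 subrr mul0r.
have Sinf : has_inf S by split; [exists (L * 1)|exists 0].
pose d := e / 4.
have d0 : 0 < d by rewrite divr_gt0.
have [a [W [A [WV [W0 oW] [cA Ak] Wa]]] ad] := inf_adherent d0 Sinf.
have WD : W `<=` D by exact: subset_trans VD.
exists W, A; split => //.
have far h B : clopen B -> B k -> sup_le h 1 ->
    (forall x, ~ (A x /\ ~ B x) -> h x = 0) -> slope_le f W h (2 * d).
  move=> cB Bk h1 hAB; apply: contrapT => /(steep_refine WD oW h1).
  move=> [W1 [W1W W10 oW1 sW1]].
  have : ~ S (inf S - d).
    by move=> Sd; have := ge_inf Sinf.2 Sd; rewrite leNgt gtrBl d0.
  move=> /forallNP/(_ W1)/forallNP/(_ (A `&` B)) nS.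
  have [h2 [h21 h2AB ns2]] : exists h2, [/\ sup_le h2 1,
      forall x, ~ (A `&` B) x -> h2 x = 0 & ~ slope_le f W1 h2 (inf S - d)].
    apply: contrapT => /forallNP nh; apply: nS; split => //.
    - exact: subset_trans W1W WV.
    - by split; [exact: clopenI|split].
    - move=> h2 h21 h2AB; apply: contrapT => ns; apply: (nh h2); split => //.
  have W1D : W1 `<=` D by exact: subset_trans WD.
  have [W2 [W2W1 W20 oW2 sW2]] := steep_refine W1D oW1 h21 ns2.
  have W2D : W2 `<=` D by exact: subset_trans W1D.
  have hh2 : sup_le (h + h2) 1.
    move=> x; rewrite CkE; have [ABx|nABx] := pselect (A x /\ ~ B x).
      by rewrite h2AB ?addr0; [exact: h1|move=> [_ /ABx.2]].
    by rewrite hAB// add0r.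
  have s1 : slope_le f W2 (h + h2) a.
    apply: (@slope_leS _ _ _ W); first exact: subset_trans W1W.
    by apply: Wa => // x nAx; rewrite CkE h2AB ?hAB ?addr0 => // -[/nAx].
  have s2 : slope_le f W2 (- (h + h2)) (- (2 * d + (inf S - d))).
    rewrite !opprD; apply: (slope_leD convf W2D oW2 (sup_leN h1) (sup_leN h21)).
      exact: slope_leS sW1.
    by rewrite -opprD.
  by have := slope_le_ge W20 oW2 hh2 s1 s2; lra.
move=> h h1 hA hk.
(* As h vanishes at k, it is at most n on a clopen B around k. The part on B costs L n <= d, the
   part off B costs 2 d by [far], and 3 d < e. *)
pose n := d / (`|L| + 1).
have L1 : 0 < `|L| + 1 by rewrite ltr_wpDl.
have n0 : 0 < n by rewrite divr_gt0.
have : nbhs k [set x | `|h x| <= n].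
  have /cvgr_norm_le := @Ck_continuous R X h k.
  by apply; rewrite hk normr0.
move=> /Xbasis[B [cB Bk Bn]].
have cB' := clopenC setT cB.
rewrite -(restrC cB cB' h).
have -> : e = L * n + (e - L * n) by rewrite subrKC.
have hB : sup_le (restr cB h) n by apply: sup_le_restr; [exact: ltW|exact: Bn].
have hB' : sup_le (restr cB' h) 1 by exact: sup_le_restr.
apply: (slope_leD convf WD oW hB hB'); first exact: lip_slope_le lipf _ _ _ WD _.
apply: (@slope_leW _ _ _ _ _ (2 * d)).
  have : L * n <= d.
    rewrite (le_trans (ler_wpM2r (ltW n0) (ler_norm L)))// /n mulrCA ger_pMr//.
    by rewrite ler_pdivrMr// mul1r lerDl.
  by rewrite /d in d0 *; lra.
apply: (far _ B) => // x nAB; have [Bx|nBx] := pselect (B x).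
  by rewrite restr_out//; apply.
by rewrite restr_in// hA//; tauto.
Qed.

End refinement.

(** * Category argument for the sup norm *)

Section sup_norm_baire.
Context {R : realType} {X : topologicalType}.
Local Notation C := (Ck R X).
Implicit Types (h y z : C) (V W : set C).

(** By the crossing inequality c_m - r_m <= c_n + r_n, the supremum of the lower envelopes c_n - r_n
    is within r_n of every c_n; as a uniform limit it is continuous. *)
Lemma sup_complete (c : nat -> C) (r : nat -> R) :
  (forall e, 0 < e -> exists n, r n < e) ->
  (forall m n, (m <= n)%N -> sup_le (c n - c m) (r m)) ->
  exists z : C, forall n, sup_le (z - c n) (r n).
Proof.
move=> r0 cr.
have crx m n x : c m x - r m <= c n x + r n.
  have [mn|/ltnW nm] := leqP m n.
    have := cr _ _ mn x; have := le_trans (normr_ge0 _) (cr n n (leqnn n) x).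
    by rewrite CkE ler_norml => ? /andP[]; lra.
  have := cr _ _ nm x; have := le_trans (normr_ge0 _) (cr m m (leqnn m) x).
  by rewrite CkE ler_norml => ? /andP[]; lra.
pose z x : R := sup [set c n x - r n | n in setT].
have zc n x : `|z x - c n x| <= r n.
  have hs : has_sup [set c n x - r n | n in setT].
    by split; [exists (c 0%N x - r 0%N), 0%N|exists (c 0%N x + r 0%N) => _ [m _ <-]].
  have : c n x - r n <= z x by apply: (ub_le_sup hs.2); exists n.
  have : z x <= c n x + r n by apply: (ge_sup hs.1) => _ [m _ <-].
  by rewrite ler_norml => ? ?; apply/andP; split; lra.
have cz : continuous (z : X -> R^o).
  move=> x; apply/cvgrPdist_le => e e0.
  have e3 : 0 < e / 3 by rewrite divr_gt0.
  have [n rn] := r0 _ e3.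
  have /cvgrPdist_le/(_ _ e3) := @Ck_continuous R X (c n) x.
  apply: filterS => y; have := zc n y; have := zc n x.
  by rewrite !ler_norml => /andP[? ?] /andP[? ?] /andP[? ?]; apply/andP; split; lra.
by exists (mkCk cz) => n x; rewrite CkE; exact: zc.
Qed.

(** Baire's theorem in terms of tasks: any open part of [V] can be shrunk to fulfil task n. Nested
    closed balls with radii tending to 0 then meet at a point that has, for each n, a neighborhood
    fulfilling task n. *)
Lemma sup_baire (T : nat -> set C -> Prop) V :
  (forall n W, W `<=` V -> W !=set0 -> sup_open W ->
    exists U, [/\ U `<=` W, U !=set0, sup_open U & T n U]) ->
  V !=set0 -> sup_open V ->
  exists2 z, V z &
    forall n, exists U, [/\ U z, U `<=` V, sup_open U & T n U].
Proof.
move=> dT [c0 Vc0] oV.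
pose ball (p : C * R) := [set y : C | sup_le (y - p.1) p.2].
pose P (p : C * R) := 0 < p.2 /\ ball p `<=` V.
have [F HF] : {F : nat * (C * R) -> C * R & forall np, P np.2 ->
    [/\ P (F np), (F np).2 <= np.1.+1%:R^-1, ball (F np) `<=` ball np.2 &
      exists U, [/\ U `<=` V, sup_open U, T np.1 U & ball (F np) `<=` U]]}.
  apply: (@choice _ _ (fun np q => P np.2 ->
    [/\ P q, q.2 <= np.1.+1%:R^-1, ball q `<=` ball np.2 &
      exists U, [/\ U `<=` V, sup_open U, T np.1 U & ball q `<=` U]])).
  move=> [n [c r]] /=; have [[/= r0 bV]|nP] := pselect (P (c, r)); last first.
    by exists (c, r) => /nP.
  (* The open ball of radius r. A strict pointwise bound by r need not define a [sup_open] set,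
     whence the smaller s. *)
  pose W := [set y : C | exists2 s, s < r & sup_le (y - c) s].
  have Wb : W `<=` ball (c, r).
    by move=> y [s sr ys]; apply: sup_leW ys; exact: ltW.
  have oW : sup_open W.
    move=> y [s sr ys]; exists ((r - s) / 2); first by rewrite divr_gt0// subr_gt0.
    move=> h hs; exists (s + (r - s) / 2); first by lra.
    by rewrite addrAC; exact: sup_leD.
  have [|U [UW [c' Uc'] oU TU]] := dT n W (subset_trans Wb bV) _ oW.
    by exists c, 0 => //; rewrite subrr; exact: sup_le0.
  have [s s0 sU] := oU _ Uc'.
  pose q : C * R := (c', Num.min s n.+1%:R^-1).
  have qU : ball q `<=` U.
    move=> y yq; rewrite -[y](subrKC c'); apply: sU; apply: sup_leW yq.
    by rewrite /= ge_min lexx.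
  exists q => _; split.
  - split; first by rewrite /= lt_min s0 /= invr_gt0.
    exact: subset_trans qU (subset_trans UW (subset_trans Wb bV)).
  - by rewrite /= ge_min lexx orbT.
  - exact: subset_trans qU (subset_trans UW Wb).
  - exists U; split => //.
    exact: subset_trans UW (subset_trans Wb bV).
have [r0 r00 r0V] := oV _ Vc0.
pose u := fix u n := if n is m.+1 then F (m, u m) else (c0, r0).
have Pu n : P (u n).
  elim: n => [|n IH]; last by have [] := HF (n, u n) IH.
  by split => // y yc; rewrite -[y](subrKC c0); exact: r0V.
have nested m n : (m <= n)%N -> ball (u n) `<=` ball (u m).
  elim: n => [|n IH]; first by rewrite leqn0 => /eqP ->.
  rewrite leq_eqVlt => /predU1P[-> //|/IH]; apply: subset_trans.
  by have [] := HF (n, u n) (Pu n).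
have [z zu] : exists z : C, forall n, sup_le (z - (u n).1) (u n).2.
  apply: sup_complete => [e e0|m n mn].
    have [n ne] : exists n, n.+1%:R^-1 < e.
      by have [n _ /(_ _ (leqnn n))] := near_infty_natSinv_lt (PosNum e0); exists n.
    exists n.+1; apply: le_lt_trans ne.
    by have [] := HF (n, u n) (Pu n).
  apply: (nested m n mn); rewrite /ball /= subrr; apply: sup_le0.
  exact/ltW/(Pu n).1.
exists z; first exact/(Pu 0%N).2/zu.
move=> n; have [_ _ _ [U [UV oU TU bU]]] := HF (n, u n) (Pu n).
by exists U; split => //; apply: bU; exact: (zu n.+1).
Qed.

End sup_norm_baire.

(** Bounds the total weight of a finite cover independently of the cover, since its points have
    distinct codes. *)
Lemma sum_half_powers (R : realType) (s : seq nat) : uniq s ->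
  \sum_(n <- s) (2^-1 : R) ^+ n <= 2.
Proof.
move=> us; pose N := (\max_(n <- s) n).+1.
have sN n : n \in s -> (n < N)%N.
  by move=> ns; rewrite ltnS; exact: leq_bigmax_seq.
rewrite (perm_big [seq n <- index_iota 0 N | n \in s]); last first.
  apply: uniq_perm => //; first by rewrite filter_uniq// iota_uniq.
  move=> n; rewrite mem_filter mem_index_iota /=.
  by case: (boolP (n \in s)) => //= /sN ->.
rewrite big_filter big_mkcond /=.
apply: (@le_trans _ _ (\sum_(0 <= n < N) 2^-1 ^+ n)).
  by apply: ler_sum => n _; case: ifP => // _; rewrite exprn_ge0// invr_ge0.
have E m : \sum_(0 <= n < m) (2^-1 : R) ^+ n = 2 - 2 * 2^-1 ^+ m.
  elim: m => [|m IH]; first by rewrite big_nil expr0 mulr1 subrr.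
  by rewrite big_nat_recr//= IH exprS; field.
by rewrite E gerBl mulr_ge0// exprn_ge0// invr_ge0.
Qed.

(** * Points near which slopes oscillate little *)

Section small_oscillation.
Context {R : realType} {X : ptopologicalType}.
Local Notation C := (Ck R X).
Variables (f : C -> R^o) (D : set C) (L : R) (K : set X) (code : X -> nat).
Hypothesis code_inj : injective code.
Hypothesis Xbasis : clopen_basis X.
Hypothesis compK : compact K.
Hypothesis convf : convex_function D f.
Hypothesis lipf : forall (y h : C) (r : R),
  D y -> D (y + h) -> sup_le h r -> f (y + h) - f y <= L * r.
Hypothesis locf : forall (y h : C),
  D y -> D (y + h) -> (forall x, K x -> h x = 0) -> f (y + h) = f y.
Hypothesis D0 : D !=set0.
Hypothesis oD : sup_open D.
Implicit Types (h : C) (V W : set C) (a e : R).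

(** The second bound keeps the slopes along h above a - e, so they range in an interval of length
    e. *)
Definition slope_osc_le W h e :=
  exists a, slope_le f W h a /\ slope_le f W (- h) (e - a).

Lemma slope_osc_leS V W h e : W `<=` V -> slope_osc_le V h e -> slope_osc_le W h e.
Proof. by move=> WV [a [? ?]]; exists a; split; exact: slope_leS WV _. Qed.

Lemma slope_osc_leD W g h (d e b c : R) : W `<=` D -> sup_open W ->
  sup_le g b -> sup_le h c -> slope_osc_le W g d -> slope_osc_le W h e ->
  slope_osc_le W (g + h) (d + e).
Proof.
move=> WD oW gb hc [a1 [s1 s1']] [a2 [s2 s2']]; exists (a1 + a2); split.
  exact: (slope_leD convf WD oW gb hc s1 s2).
rewrite !opprD addrACA.
exact: (slope_leD convf WD oW (sup_leN gb) (sup_leN hc) s1' s2').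
Qed.

Lemma slope_osc_leN W h e : slope_osc_le W h e -> slope_osc_le W (- h) e.
Proof. by move=> [a [s s']]; exists (e - a); rewrite opprK subKr. Qed.

Lemma slope_osc_leZ W h (b e : R) : `|b| <= 1 -> 0 <= e ->
  slope_osc_le W h e -> slope_osc_le W (b *: h) e.
Proof.
wlog b0 : b h / 0 <= b => [H b1 e0 he|].
  have [b0|b0] := leP 0 b; first exact: H.
  rewrite -[b]opprK scaleNr -scalerN; apply: H; rewrite ?normrN ?oppr_ge0//.
    exact: ltW.
  exact: slope_osc_leN.
rewrite ger0_norm// => b1 e0 [a [s s']]; exists (b * a); split.
  exact: slope_leZ.
rewrite -scalerN; apply: slope_leW (slope_leZ b0 s').
by rewrite mulrBr lerB// ler_piMl.
Qed.

Let weight k j : R := 2^-1 ^+ (code k + j).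

Let weight_gt0 k j : 0 < weight k j.
Proof. by rewrite exprn_gt0// invr_gt0. Qed.

(** A direction supported by [A] is a multiple of the indicator of [A] plus a direction vanishing at
    k; the task controls both, with weights summable over k. *)
Let task k j W := exists A, A k /\ exists cA : clopen A,
  (forall h, sup_le h 1 -> (forall x, ~ A x -> h x = 0) -> h k = 0 ->
    slope_le f W h (weight k j)) /\
  slope_osc_le W (restr cA (Ck_one : C)) (weight k j).

Let task_dense k j V : V `<=` D -> V !=set0 -> sup_open V ->
  exists W, [/\ W `<=` V, W !=set0, sup_open W & task k j W].
Proof.
move=> VD V0 oV.
have [W [A [WV [W0 oW] [cA Ak] sW]]] :=
  concentrate Xbasis convf lipf k VD V0 oV (weight_gt0 k j).
have one_le : sup_le (restr cA (Ck_one : C)) 1.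
  by apply: sup_le_restr => // x _; rewrite /= normr1.
have [U [a [UW U0 oU sU]]] := flat_refine convf lipf (subset_trans WV VD) W0 oW
  one_le (weight_gt0 k j).
exists U; split => //; first exact: subset_trans WV.
exists A; split => //; exists cA; split; last by exists a.
by move=> h h1 hA hk; apply: slope_leS UW _; exact: sW.
Qed.

(** Subtract from h its value at k times the indicator of [A]. The difference is bounded by 2, so it
    is halved first; its slopes lie in [-2 e, 2 e], an oscillation of 4 e, and the subtracted term
    adds e. *)
Let slope_osc_le_piece W A (cA : clopen A) k h e : 0 <= e ->
  W `<=` D -> sup_open W -> A k -> 
  (forall h, sup_le h 1 -> (forall x, ~ A x -> h x = 0) -> h k = 0 ->
    slope_le f W h e) ->
  slope_osc_le W (restr cA (Ck_one : C)) e ->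
  sup_le h 1 -> (forall x, ~ A x -> h x = 0) -> slope_osc_le W h (5 * e).
Proof.
move=> e0 WD oW Ak sW oscW h1 hA.
pose g : C := h k *: restr cA (Ck_one : C).
have one_le : sup_le (restr cA (Ck_one : C)) 1.
  by apply: sup_le_restr => // x _; rewrite /= normr1.
have g1 : sup_le g 1.
  have := sup_leZ (h k) one_le; apply: sup_leW.
  by rewrite mulr1; exact: h1.
have hg1 : sup_le (2^-1 *: (h - g)) 1.
  have := sup_leZ 2^-1 (sup_leD h1 (sup_leN g1)); apply: sup_leW.
  by rewrite gtr0_norm ?mulVf.
have vanish x : ~ A x -> Ck_fun (h - g) x = 0.
  by move=> nA; rewrite !CkE restr_out// hA// mulr0 subrr.
have vanishk : Ck_fun (h - g) k = 0.
  by rewrite !CkE restr_in//= [X in _ * X](_ : _ = 1)// mulr1 subrr.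
have hg : slope_osc_le W (2 *: (2^-1 *: (h - g))) (4 * e).
  exists (2 * e); split.
    apply: slope_leZ => //; apply: sW => // [x nA|]; first by rewrite CkZE vanish// mulr0.
    by rewrite CkZE vanishk mulr0.
  rewrite (_ : 4 * e - 2 * e = 2 * e); last by ring.
  rewrite -[- (2 *: _)]scalerN -[- (2^-1 *: _)]scalerN.
  apply: slope_leZ => //; apply: sW.
  - by rewrite scalerN; exact: sup_leN hg1.
  - by move=> x nA; rewrite scalerN CkNE CkZE vanish// mulr0 oppr0.
  - by rewrite scalerN CkNE CkZE vanishk mulr0 oppr0.
rewrite -[h](subrK g) (_ : 5 * e = 4 * e + e); last by ring.
have hg2 : sup_le (h - g) (1 + 1) by exact: sup_leD h1 (sup_leN g1).
apply: (slope_osc_leD WD oW hg2 g1).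
  by move: hg; rewrite scalerA divff// scale1r.
exact: slope_osc_leZ.
Qed.

(** The category argument runs over the countably many pairs (k, j). Given e, one j is fixed;
    finitely many of the sets A_k cover [K], and their oscillations add up to at most e. *)
Lemma exists_small_osc : exists2 z, D z & forall e : R, 0 < e ->
  exists W, [/\ W z, W `<=` D, sup_open W &
    forall h, sup_le h 1 -> slope_osc_le W h e].
Proof.
pose T n W := forall k j, n = pickle (code k, j) -> task k j W.
have dT n W : W `<=` D -> W !=set0 -> sup_open W ->
    exists U, [/\ U `<=` W, U !=set0, sup_open U & T n U].
  move=> WD W0 oW.
  have [[k [j nkj]]|nn] := pselect (exists k (j : nat), n = pickle (code k, j)).
    have [U [? ? ? tU]] := task_dense k j WD W0 oW.
    exists U; split => // k' j'; rewrite nkj => /(pcan_inj pickleK)[/code_inj <- <-].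
    exact: tU.
  by exists W; split => // k j nkj; exfalso; apply: nn; exists k, j.
have [z Dz Tz] := sup_baire dT D0 oD.
exists z => // e e0.
(* Each piece costs 5 times its weight and the weights sum to at most 2 * 2^-j, whence the factor
   10. *)
have [j je] : exists j, 10 * 2^-1 ^+ j <= e.
  have e10 : 0 < e / 10 by rewrite divr_gt0.
  have [j _ /(_ _ (leqnn j)) /= ej] := near_infty_natSinv_expn_lt (PosNum e10).
  by exists j; rewrite mulrC -ler_pdivlMr// exprVn -div1r ltW.
have tz k : exists U, [/\ U z, U `<=` D, sup_open U & task k j U].
  have [U [? ? ? TU]] := Tz (pickle (code k, j)); exists U; split => //.
  exact: TU.
have [U HU] := choice tz.
have tA k : exists A, A k /\ exists cA : clopen A,
  (forall h, sup_le h 1 -> (forall x, ~ A x -> h x = 0) -> h k = 0 ->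
    slope_le f (U k) h (weight k j)) /\
  slope_osc_le (U k) (restr cA (Ck_one : C)) (weight k j) by have [] := HU k.
have [A HA] := choice tA.
have cA k : clopen (A k) by have [_ []] := HA k.
move: compK; rewrite compact_cover => /(_ X setT A) [].
- by move=> k _; exact: (cA k).1.
- by move=> x Kx; exists x => //; exact: (HA x).1.
move=> S _ KS.
pose s : seq X := finmap.enum_fset S.
have us : uniq s by exact: finmap.fset_uniq.
have [W [Wz WD oW WU]] : exists W, [/\ W z, W `<=` D, sup_open W &
    forall k, k \in s -> W `<=` U k].
  elim: (s) => [|k s' [W [Wz WD oW WU]]]; first by exists D; split.
  have [Uz UD oU _] := HU k.
  exists (W `&` U k); split => //; first by move=> y [/WD].
    exact: sup_openI.
  move=> k'; rewrite in_cons => /predU1P[->|/WU WU' y [/WU']//].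
  by move=> y [].
exists W; split => // h h1.
have supp x : K x -> h x != 0 -> exists2 k, k \in s & A k x.
  by move=> /KS[k /= kS Akx] _; exists k.
have : slope_osc_le W h (\sum_(k <- s) 5 * weight k j).
  (* Each step cuts off the part of h on [A k]; the rest vanishes there, so the remaining sets still
     cover its support in [K]. When none remain, h vanishes on [K] and [locf] makes f constant along
     it. *)
  elim: (s) h h1 supp WU => [|k s' IH] h h1 supp WU.
    rewrite big_nil; exists 0; rewrite subr0.
    have h0 x : K x -> h x = 0.
      by move=> Kx; apply/eqP; apply: contrapT => /negP /(supp _ Kx)[].
    split=> y t t0 Wy Wyt.
      rewrite locf ?mul0r ?subrr//; [exact: WD..|].
      by move=> x Kx; rewrite CkE h0// mulr0.
    rewrite locf ?mul0r ?subrr//; [exact: WD..|].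
    by move=> x Kx; rewrite CkZE CkNE h0// oppr0 mulr0.
  have cA' := clopenC setT (cA k).
  rewrite big_cons -(restrC (cA k) cA' h).
  have h1' : sup_le (restr (cA k) h) 1 by exact: sup_le_restr.
  have h1'' : sup_le (restr cA' h) 1 by exact: sup_le_restr.
  apply: (slope_osc_leD WD oW h1' h1'').
    have [Akk [cA0 [sk ok]]] := HA k.
    have WUk : W `<=` U k by apply: WU; rewrite mem_head.
    apply: (slope_osc_le_piece (cA := cA0) (ltW (weight_gt0 k j)) WD oW Akk).
    - by move=> g g1 gA gk; apply: slope_leS WUk _; exact: sk.
    - exact: slope_osc_leS WUk ok.
    - exact: h1'.
    - by move=> x nA; rewrite restr_out.
  apply: IH => // [x Kx|k' k's]; last by apply: WU; rewrite in_cons k's orbT.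
  have [Akx|nAkx] := pselect (A k x).
    by rewrite restr_out ?eqxx//; apply.
  rewrite restr_in// => /(supp _ Kx)[k']; rewrite in_cons => /predU1P[->//|].
  by exists k'.
move=> [a [s1 s2]]; exists a; split => //; apply: slope_leW s2.
rewrite lerD2r (le_trans _ je)// -mulr_sumr.
rewrite (_ : 10 = 5 * 2); last by ring.
rewrite -mulrA ler_pM2l//.
rewrite (eq_bigr (fun k => 2^-1 ^+ code k * 2^-1 ^+ j)); last first.
  by move=> k _; rewrite -exprD.
rewrite -mulr_suml ler_pM2r ?exprn_gt0 ?invr_gt0//.
rewrite -(big_map code xpredT (fun n => 2^-1 ^+ n)).
by apply: sum_half_powers; rewrite map_inj_uniq.
Qed.

End small_oscillation.

(** * Basic neighborhoods of the compact-open topology *)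

Section tubes.
Context {R : realType} {X : topologicalType}.
Local Notation C := (Ck R X).
Implicit Types (f : C -> R^o) (D : set C) (g h x y z : C) (K : set X) (r : R).

Definition tube K r x : set C := [set g | forall q, K q -> `|g q - x q| < r].

Lemma nbhs_tube K r x : compact K -> 0 < r -> nbhs x (tube K r x).
Proof.
move=> cK r0; apply/Ck_nbhsP.
exists [set g : C | forall q, K q -> `|g q| < r]; first by exists K, r.
by move=> g gK q /gK; rewrite CkE.
Qed.

Lemma tube_basis x (U : set C) : nbhs x U ->
  exists K r, [/\ compact K, 0 < r & tube K r x `<=` U].
Proof.
move=> /Ck_nbhsP[_ [K [r [cK r0 ->]]] bU]; by exists K, r.
Qed.

Let clipr (r a : R) := Num.max (- r) (Num.min r a).

Let clipr_lip r a b : 0 <= r -> `|clipr r a - clipr r b| <= `|a - b|.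
Proof.
rewrite /clipr => r0; rewrite ler_norml; have := ler_norm (a - b).
have := ler_norm (- (a - b)); rewrite normrN.
move=> ? ?; rewrite /Num.min.
by do 2 case: ltP => ?; rewrite /Num.max; do 2 case: ltP => ?;
  apply/andP; split; lra.
Qed.

Let clipr_le r a : 0 <= r -> `|clipr r a| <= r.
Proof.
rewrite /clipr => r0; rewrite ler_norml /Num.min.
by case: ltP => ?; rewrite /Num.max; case: ltP => ?; apply/andP; split; lra.
Qed.

Let clipr_id r a : `|a| <= r -> clipr r a = a.
Proof. by rewrite ler_norml /clipr => /andP[? ?]; rewrite min_r// max_r. Qed.

Let clip_continuous (g : C) r : 0 <= r ->
  continuous (fun q => clipr r (g q) : R^o).
Proof.
move=> r0 q; apply/cvgrPdist_lt => e e0.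
have /cvgrPdist_lt/(_ _ e0) := @Ck_continuous R X g q.
by apply: filterS => p; apply: le_lt_trans; exact: clipr_lip.
Qed.

(** Truncation makes a direction that is bounded only on a compact set bounded everywhere, without
    changing it on that set. *)
Lemma clip g r : 0 <= r ->
  exists2 h : C, sup_le h r & forall q, `|g q| <= r -> h q = g q.
Proof.
move=> r0; exists (mkCk (clip_continuous (g := g) r0)) => q.
  exact: clipr_le.
exact: clipr_id.
Qed.

(** Moving along a direction that vanishes on [K] never leaves the tube, and a convex function
    bounded along a whole line is constant on it. *)
Lemma convex_tube_const f D K r x (M : R) : convex_function D f -> 
  tube K r x `<=` D -> (forall g, tube K r x g -> `|f g - f x| <= M) ->
  forall y h, tube K r x y -> (forall q, K q -> h q = 0) -> f (y + h) = f y.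
Proof.
move=> cf tD fM.
have tubeD y h : tube K r x y -> (forall q, K q -> h q = 0) ->
    tube K r x (y + h).
  by move=> ty h0 q Kq; rewrite CkE h0// addr0; exact: ty.
have le_ y h : tube K r x y -> (forall q, K q -> h q = 0) -> f (y + h) <= f y.
  move=> ty h0; rewrite leNgt; apply/negP => lt_.
  have d0 : 0 < f (y + h) - f y by rewrite subr_gt0.
  have M0 : 0 <= M by rewrite (le_trans _ (fM _ ty)).
  (* With this s convexity forces a further increase of 2 M + 1, while f varies by at most 2 M in
     the tube. *)
  pose s := (2 * M + 1) / (f (y + h) - f y).
  have s0 : 0 < s by rewrite divr_gt0// ltr_wpDl// mulr_ge0.
  have tyh := tubeD _ _ ty h0.
  have tz : tube K r x (y + 1 *: h + s *: h).
    rewrite scale1r; apply: tubeD => // q Kq.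
    by rewrite CkE h0// mulr0.
  have := convex_slopes cf ltr01 s0 (tD _ ty) (tD _ tz).
  rewrite scale1r mul1r /s divfK ?gt_eqF//.
  have := fM _ tz; have := fM _ tyh; rewrite scale1r !ler_norml.
  by move=> /andP[? ?] /andP[? ?] ?; lra.
move=> y h ty h0; apply/eqP; rewrite eq_le le_//=.
have := le_ (y + h) (- h) (tubeD _ _ ty h0); rewrite addrK; apply.
by move=> q Kq; rewrite CkE h0// oppr0.
Qed.

Lemma continuous_on_tube f D x (U : set C) : continuous_convex_on D f -> D x ->
  nbhs x U -> exists K r, [/\ compact K, 0 < r, tube K r x `<=` D,
    tube K r x `<=` U & forall g, tube K r x g -> `|f g - f x| <= 1].
Proof.
move=> [_ oD _ cfD _] Dx xU.
have cfx : {for x, continuous f}.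
  by move: cfD; rewrite continuous_open_subspace// => /(_ x (mem_set Dx)).
have xD : nbhs x D by apply: open_nbhs_nbhs.
have /cvgrPdist_le/(_ _ ltr01) fx := cfx.
have [K [r [cK r0 tV]]] := tube_basis (filterI (filterI xD xU) fx).
exists K, r; split => //.
- by move=> g /tV[[]].
- by move=> g /tV[[]].
- by move=> g /tV[_]; rewrite distrC.
Qed.

End tubes.

(** * Density of almost smooth points *)

Section almost_smooth.
Context {R : realType} {X : ptopologicalType}.
Local Notation C := (Ck R X).
Variables (f : C -> R^o) (D : set C) (code : X -> nat).
Hypothesis code_inj : injective code.
Hypothesis Xbasis : clopen_basis X.
Hypothesis fD : continuous_convex_on D f.

(** Symmetric second differences test the smoothness of a convex function without naming a
    derivative. Divided by t they decrease as t does, so a single t controls all smaller ones. *)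
Definition almost_smooth (e : R) (x : C) := exists2 t : R, 0 < t &
  forall y, sup_le y 1 -> [/\ D (x + t *: y), D (x - t *: y) &
    f (x + t *: y) + f (x - t *: y) - 2 * f x <= t * e].

Lemma exists_almost_smooth x0 (U : set C) : D x0 -> nbhs x0 U ->
  exists2 z, U z & forall e, 0 < e -> nbhs z (almost_smooth e).
Proof.
move=> Dx0 x0U.
have [K [r [cK r0 tD tU f1]]] := continuous_on_tube fD Dx0 x0U.
have cf : convex_function D f by case: fD.
have loc := convex_tube_const cf tD f1.
pose V : set C := [set y | exists2 s, s < r / 2 & sup_le (y - x0) s].
have Vt : V `<=` tube K r x0.
  by move=> y [s sr ys] q _; have := ys q; rewrite CkE; lra.
have VD : V `<=` D by exact: subset_trans tD.
have V0 : V !=set0.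
  by exists x0, 0; [rewrite divr_gt0|rewrite subrr; exact: sup_le0].
have oV : sup_open V.
  move=> y [s sr ys]; exists ((r / 2 - s) / 2).
    by rewrite divr_gt0// subr_gt0.
  move=> h hs; exists (s + (r / 2 - s) / 2); first by lra.
  by rewrite addrAC; exact: sup_leD.
have cfV : convex_function V f.
  move=> t x y /set_mem/VD Dx /set_mem/VD Dy; apply: cf; exact/mem_set.
(* The segment can be prolonged past [y + h] by a vector of size at most r/2 inside the tube, where
   f varies by at most 2; this gives the constant 4 / r. *)
have lipf y h e : V y -> V (y + h) -> sup_le h e -> f (y + h) - f y <= 4 / r * e.
  move=> Vy Vyh he.
  have := le_trans (normr_ge0 _) (he point); rewrite le_eqVlt => /predU1P[e0|e0].
    rewrite -e0 mulr0 (_ : h = 0) ?addr0 ?subrr//.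
    apply: Ck_eqP => q; apply/eqP; rewrite -normr_le0 e0; exact: he.
  pose s := r / (2 * e).
  have s0 : 0 < s by rewrite divr_gt0// mulr_gt0.
  have tz : tube K r x0 (y + 1 *: h + s *: h).
    case: Vyh => c cr yhc q _; rewrite scale1r CkDE CkZE addrAC.
    have := yhc q; rewrite CkBE => H1.
    have H2 : `|s * h q| <= r / 2.
      rewrite normrM (gtr0_norm s0) (le_trans (ler_wpM2l (ltW s0) (he q)))//.
      by rewrite /s le_eqVlt; apply/orP; left; apply/eqP; field; rewrite gt_eqF.
    by rewrite (le_lt_trans (ler_normD _ _))//; lra.
  have := convex_slopes cf ltr01 s0 (VD _ Vy) (tD _ tz).
  rewrite scale1r mul1r.
  have := f1 _ tz; have := f1 _ (Vt _ Vyh); rewrite scale1r !ler_norml.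
  move=> /andP[? ?] /andP[? ?] H.
  rewrite -(ler_pM2l s0) (le_trans H)//.
  rewrite [leRHS](_ : _ = 2); first by lra.
  by rewrite /s; field; rewrite !gt_eqF.
have locV y h : V y -> V (y + h) -> (forall q, K q -> h q = 0) ->
    f (y + h) = f y.
  by move=> /Vt ty _; exact: loc.
have [z Vz oscz] := exists_small_osc code_inj Xbasis cK cfV lipf locV V0 oV.
exists z; first exact/tU/Vt.
move=> e e0.
have [W [Wz WV oW oscW]] := oscz _ e0.
have [d d0 dW] := oW _ Wz.
pose t := d / 2.
have t0 : 0 < t by rewrite divr_gt0.
apply: filterS (nbhs_tube z cK t0) => x xz.
(* Here x is close to z on [K] only. Truncating x - z yields x', close to z everywhere and equal to
   x on [K], so that [loc] carries the estimates on [W] over to x. *)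
have [g gt gxz] := clip (x - z) (ltW t0).
pose x' := z + g.
have xx' q : K q -> Ck_fun (x - x') q = 0.
  move=> Kq; rewrite !CkE gxz ?CkE; first by ring.
  exact/ltW/xz.
have sameK y : sup_le y t -> D (x + y) /\ f (x + y) = f (x' + y).
  move=> yt; have Wy : W (x' + y).
    by rewrite -addrA; apply: dW; rewrite [d]splitr; exact: sup_leD.
  have E : x + y = x' + y + (x - x') by rewrite addrAC subrKC.
  have ty := Vt _ (WV _ Wy).
  split; last by rewrite E loc.
  apply: tD => q Kq; rewrite E CkDE xx'// addr0; exact: ty.
exists t => // y y1.
have yt : sup_le (t *: y) t.
  by have := sup_leZ t y1; rewrite mulr1 gtr0_norm.
have [D1 E1] := sameK _ yt.
have [D2 E2] := sameK _ (sup_leN yt).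
have [_ E3] := sameK _ (sup_le0 (ltW t0)).
rewrite !addr0 in E3.
split => //; rewrite E1 E2 E3.
have Wx y' : sup_le y' t -> W (x' + y').
  by move=> yt'; rewrite -addrA; apply: dW; rewrite [d]splitr; exact: sup_leD.
have Wx' : W x' by rewrite -[x']addr0; apply: Wx; exact: sup_le0 (ltW t0).
have [a [s1 s2]] := oscW _ y1.
have := s1 x' t t0 Wx' (Wx _ yt).
have := s2 x' t t0 Wx'; rewrite scalerN => /(_ (Wx _ (sup_leN yt))).
lra.
Qed.

End almost_smooth.

(** * Frechet differentiability *)

Lemma linear_bundle (R : realType) (E : lmodType R) (F : lmodType R) (g : E -> F) :
  linear g -> exists l : {linear E -> F}, l =1 g.
Proof.
move=> lg.
pose l : {linear E -> F} := HB.pack g (GRing.isLinear.Build R E F *:%R g lg).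
by exists l.
Qed.

Section first_order.
Context {R : realType} {E : lmodType R}.
Variables (f : E -> R^o) (D : set E) (x : E).
Hypothesis cf : convex_function D f.
Hypothesis cD : convex_set D.
Hypothesis Dx : D x.
Implicit Types (y z : E) (s t e l m : R).

Definition first_order y l := forall e, 0 < e -> exists2 t, 0 < t &
  forall s, `|s| <= t -> `|f (x + s *: y) - f x - s * l| <= e * `|s|.

Lemma first_order_unique y l m : first_order y l -> first_order y m -> l = m.
Proof.
move=> fl fm; apply/eqP; rewrite -subr_eq0 -normr_le0.
apply/ler_addgt0Pl => e e0; rewrite addr0.
have e2 : 0 < e / 2 by rewrite divr_gt0.
have [t t0 tl] := fl _ e2; have [t' t'0 tm] := fm _ e2.
pose s := Num.min t t'.
have s0 : 0 < s by rewrite lt_min t0.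
have := tl s; rewrite gtr0_norm// ge_min lexx => /(_ isT) H1.
have := tm s; rewrite gtr0_norm// ge_min lexx orbT => /(_ isT) H2.
rewrite -(ler_pM2l s0) -[X in X * `|_|]gtr0_norm// -normrM.
rewrite mulrBr [X in `|X|](_ : _ =
  (f (x + s *: y) - f x - s * m) - (f (x + s *: y) - f x - s * l)); last first.
  by ring.
by rewrite (le_trans (ler_normB _ _))//; lra.
Qed.

Lemma first_orderZ y l (a : R) : first_order y l -> first_order (a *: y) (a * l).
Proof.
move=> fl e e0; have a0 : 0 < `|a| + 1 by rewrite ltr_wpDl.
have [t t0 tl] := fl (e / (`|a| + 1)) (divr_gt0 e0 a0).
exists (t / (`|a| + 1)) => [|s]; first by rewrite divr_gt0.
rewrite ler_pdivlMr// => st; rewrite scalerA mulrA.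
have sa : `|s| * `|a| <= `|s| * (`|a| + 1) by rewrite ler_wpM2l// lerDl.
have := tl (s * a); rewrite normrM => /(_ (le_trans sa st)) /le_trans; apply.
by rewrite -mulrA ler_wpM2l ?(ltW e0)// [leLHS]mulrC ler_pdivrMr.
Qed.

Let half_double (v : E) : 2^-1 *: (v + v) = v.
Proof. by rewrite -mulr2n -[v *+ 2]scaler_nat scalerA mulVf// scale1r. Qed.

(** Above: x + s (y + z) is the midpoint of x + 2 s y and x + 2 s z. Below: x is the midpoint of x +
    s (y + z) and x - s (y + z), so the upper estimate at - s suffices. *)
Lemma first_orderD y z l m : (forall y, exists2 t, 0 < t & forall s,
    `|s| <= t -> D (x + s *: y)) ->
  first_order y l -> first_order z m -> first_order (y + z) (l + m).
Proof.
move=> oD fl fm.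
have upper e : 0 < e -> exists2 t, 0 < t & forall s, `|s| <= t ->
    f (x + s *: (y + z)) - f x - s * (l + m) <= e * `|s|.
  move=> e0; have e2 : 0 < e / 2 by rewrite divr_gt0.
  have [t1 t10 tl] := fl _ e2; have [t2 t20 tm] := fm _ e2.
  have [t3 t30 tD] := oD y; have [t4 t40 tD'] := oD z.
  pose t := Num.min (Num.min t1 t2) (Num.min t3 t4).
  have t0 : 0 < t by rewrite !lt_min t10 t20 t30 t40.
  exists (t / 2) => [|s]; first by rewrite divr_gt0.
  rewrite ler_pdivlMr// mulrC => st.
  have n2 : `|2 * s| = 2 * `|s| by rewrite normrM ger0_norm.
  have := st; rewrite -n2 !le_min => /andP[/andP[s1 s2] /andP[s3 s4]].
  have h0 : 0 <= (2^-1 : R) by rewrite invr_ge0.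
  have h1 : (2^-1 : R) <= 1 by rewrite invf_le1// ler1n.
  move/convex_functionP : cf => /(_ _ _ _ h0 h1 (tD _ s3) (tD' _ s4)).
  have hE : 1 - 2^-1 = 2^-1 :> R by field.
  rewrite hE -scalerDr addrACA scalerDr half_double -scalerDr scalerA mulrA.
  rewrite mulVf// mul1r.
  have := tl _ s1; have := tm _ s2; rewrite n2 !ler_norml.
  by move=> /andP[? ?] /andP[? ?] ?; lra.
move=> e e0; have e2 : 0 < e / 2 by rewrite divr_gt0.
have [t t0 tu] := upper _ e0.
have [t' t'0 tD] := oD (y + z).
exists (Num.min t t') => [|s]; first by rewrite lt_min t0.
rewrite le_min => /andP[st st'].
have h0 : 0 <= (2^-1 : R) by rewrite invr_ge0.
have h1 : (2^-1 : R) <= 1 by rewrite invf_le1// ler1n.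
have sN : `|- s| <= t' by rewrite normrN.
move/convex_functionP : cf => /(_ _ _ _ h0 h1 (tD _ st') (tD _ sN)).
have hE : 1 - 2^-1 = 2^-1 :> R by field.
rewrite hE -scalerDr addrACA [(- s) *: _]scaleNr subrr addr0 half_double.
have := tu (- s); have := tu s; rewrite normrN scaleNr => /(_ st) ? /(_ st) ? ?.
by rewrite ler_norml; apply/andP; split; lra.
Qed.

Lemma convex_set_segment y s t : 0 < s -> s <= t -> D (x + t *: y) ->
  D (x + s *: y).
Proof.
move=> s0 st Dt; have t0 : 0 < t := lt_le_trans s0 st.
have h0 : 0 <= s / t by rewrite divr_ge0// ltW.
have h1 : s / t <= 1 by rewrite ler_pdivrMr// mul1r.
have /convex_setP/(_ _ _ _ h0 h1 Dt Dx) := cD.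
by rewrite scalerDr addrAC -scalerDl subrKC scale1r scalerA divfK ?gt_eqF.
Qed.

Lemma convex_shrink y s t : 0 < s -> s <= t -> D (x + t *: y) ->
  t * (f (x + s *: y) - f x) <= s * (f (x + t *: y) - f x).
Proof.
move=> s0 st Dt; have t0 : 0 < t := lt_le_trans s0 st.
have h0 : 0 <= s / t by rewrite divr_ge0// ltW.
have h1 : s / t <= 1 by rewrite ler_pdivrMr// mul1r.
move/convex_functionP : cf => /(_ _ _ _ h0 h1 Dt Dx).
rewrite scalerDr addrAC -scalerDl subrKC scale1r scalerA divfK ?gt_eqF// => H.
have := ler_wpM2l (ltW t0) H.
rewrite [leRHS](_ : _ = s * f (x + t *: y) + (t - s) * f x); last first.
  by field; rewrite gt_eqF.
by lra.
Qed.

(** For convex f the difference quotients decrease as t does, so this infimum is the right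
    derivative along y. *)
Definition right_slope y : R :=
  inf [set (f (x + t *: y) - f x) / t | t in [set t | 0 < t /\ D (x + t *: y)]].

(** Backward quotients lie below [right_slope] and forward ones above, so the errors on both sides
    are nonnegative and add up to the symmetric difference. Convexity scales its bound from t down
    to |s|. *)
Lemma right_slope_first_order y t e : 0 < t -> D (x + t *: y) -> D (x - t *: y) ->
  f (x + t *: y) + f (x - t *: y) - 2 * f x <= t * e ->
  forall s, `|s| <= t ->
    `|f (x + s *: y) - f x - s * right_slope y| <= e * `|s|.
Proof.
move=> t0 Dt DNt sd.
pose S := [set (f (x + t *: y) - f x) / t | t in [set t | 0 < t /\ D (x + t *: y)]].
have DNt' : D (x + t *: - y) by rewrite scalerN.
have DxN s : 0 < s -> s <= t -> D (x - s *: y) /\ D (x + s *: y).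
  move=> s0 st; split; last exact: convex_set_segment Dt.
  by rewrite -scalerN; exact: convex_set_segment DNt'.
have lb s : 0 < s -> D (x - s *: y) -> lbound S ((f x - f (x - s *: y)) / s).
  move=> s0 Ds _ [u [u0 Du] <-].
  have := @convex_slopes _ _ D f (x - s *: y) y s u cf s0 u0 Ds.
  rewrite subrK => /(_ Du) H; rewrite ler_pdivrMr// mulrAC ler_pdivlMr//.
  by rewrite mulrC [leRHS]mulrC.
have Slb : has_lbound S by exists ((f x - f (x - t *: y)) / t); exact: lb.
have S0 : S !=set0 by exists ((f (x + t *: y) - f x) / t), t.
have le_ s : 0 < s -> D (x + s *: y) -> s * right_slope y <= f (x + s *: y) - f x.
  by move=> s0 Ds; rewrite mulrC -ler_pdivlMr//; apply: ge_inf => //; exists s.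
have ge_ s : 0 < s -> D (x - s *: y) -> f x - f (x - s *: y) <= s * right_slope y.
  by move=> s0 Ds; rewrite mulrC -ler_pdivrMr//; apply: lb_le_inf => //; exact: lb.
have lt_ := le_ _ t0 Dt; have gt_ := ge_ _ t0 DNt.
have pos s : 0 < s -> s <= t ->
    0 <= f (x + s *: y) - f x - s * right_slope y <= e * s /\
    0 <= f (x - s *: y) - f x + s * right_slope y <= e * s.
  move=> s0 st; have [DN Dp] := DxN _ s0 st.
  have := le_ _ s0 Dp; have := ge_ _ s0 DN => H1 H2.
  have H3 := convex_shrink s0 st Dt.
  have H4 := convex_shrink s0 st DNt'; rewrite !scalerN in H4.
  split; apply/andP; split; try lra; rewrite -(ler_pM2l t0); nra.
move=> s st; have [s0|s0|->] := ltgtP s 0.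
- have := pos (- s); rewrite oppr_gt0 s0 => /(_ isT).
  rewrite -{1}(ltr0_norm s0) => /(_ st)[_].
  rewrite scaleNr opprK mulNr (ltr0_norm s0) => /andP[? ?].
  by rewrite ger0_norm.
- have := pos s s0; rewrite -{1}(gtr0_norm s0) => /(_ st)[+ _] => /andP[? ?].
  by rewrite ger0_norm// gtr0_norm.
- by rewrite scale0r addr0 subrr mul0r subrr normr0 mulr0.
Qed.

End first_order.

Section frechet.
Context {R : realType} {X : ptopologicalType}.
Local Notation C := (Ck R X).
Variables (f : C -> R^o) (D : set C).
Hypothesis fD : continuous_convex_on D f.

Lemma compact_scale (K : set X) (y : C) : compact K ->
  exists2 c : R, 0 < c & forall q, K q -> `|Ck_fun (c *: y) q| <= 1.
Proof.
move=> cK.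
have /compact_bounded[M [_ MK]] : compact (y @` K : set R^o).
  apply: continuous_compact => //; apply: continuous_subspaceT.
  exact: Ck_continuous.
have M1 : 0 < `|M| + 1 by rewrite ltr_wpDl.
exists (`|M| + 1)^-1 => [|q Kq]; first by rewrite invr_gt0.
rewrite CkZE normrM gtr0_norm ?invr_gt0// mulrC ler_pdivrMr// mul1r.
apply: (MK (`|M| + 1)); last by exists q.
by rewrite (le_lt_trans (ler_norm M))// ltrDl.
Qed.

(** The estimates are uniform over directions bounded by 1 on a compact [K]. Uniqueness of
    first-order terms gives linearity, a bound on those directions gives continuity, and bounded
    sets lie in multiples of [tube K 1 0]. *)
Lemma frechet_of_almost_smooth x : D x ->
  (forall e, 0 < e -> almost_smooth f D e x) -> frechet_differentiable f x.
Proof.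
move=> Dx sm.
have [K [r [cK r0 tD _ f1]]] := continuous_on_tube fD Dx (filterT : nbhs x setT).
have [_ _ cD _ cf] := fD.
have loc := convex_tube_const cf tD f1.
have intube (y : C) s : (forall q, K q -> `|y q| <= 1) -> `|s| <= r / 2 ->
    tube K r x (x + s *: y).
  move=> y1 sr q Kq; rewrite CkDE addrC addKr CkZE normrM.
  by have := ler_pM (normr_ge0 _) (normr_ge0 _) sr (y1 _ Kq); lra.
have unif e : 0 < e -> exists2 t : R, 0 < t &
    forall y : C, (forall q, K q -> `|y q| <= 1) -> forall s, `|s| <= t ->
    [/\ tube K r x (x + s *: y) &
      `|f (x + s *: y) - f x - s * right_slope f D x y| <= e * `|s|].
  move=> e0; have [t0 t00 H] := sm _ e0.
  pose t := Num.min t0 (r / 2).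
  have tp : 0 < t by rewrite lt_min t00 divr_gt0.
  have tt0 : t <= t0 by rewrite ge_min lexx.
  have tr : t <= r / 2 by rewrite ge_min lexx orbT.
  exists t => // y y1 s st.
  split; first by apply: intube => //; exact: le_trans tr.
  (* [almost_smooth] concerns directions bounded everywhere; the truncation y' agrees with y on [K]
     and so gives the same values of f in the tube. *)
  have [y' y'1 yy'] := clip y (ler01 : 0 <= 1 :> R).
  have same u : `|u| <= t -> f (x + u *: y) = f (x + u *: y').
    move=> ut; have ty : tube K r x (x + u *: y).
      by apply: intube => //; exact: le_trans tr.
    rewrite -(loc _ (u *: (y' - y)) ty) => [|q Kq].
      by rewrite scalerBr -addrA subrKC.
    by rewrite CkZE CkBE yy' ?y1// subrr mulr0.
  have tn : `|t| <= t by rewrite gtr0_norm.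
  have tnN : `|- t| <= t by rewrite normrN.
  have Dt : D (x + t *: y) by apply/tD/intube => //; exact: le_trans tr.
  have DNt : D (x - t *: y).
    by rewrite -scaleNr; apply/tD/intube => //; exact: le_trans tr.
  apply: (right_slope_first_order cf cD Dx tp Dt DNt) => //.
  have [D1 D2 sd] := H _ y'1.
  have H1 := convex_shrink cf Dx tp tt0 D1.
  have := @convex_shrink _ _ f D x cf Dx (- y') t t0 tp tt0.
  rewrite !scalerN => /(_ D2) H2.
  rewrite -scaleNr !same// scaleNr -(ler_pM2l t00).
  have := ler_wpM2l (ltW tp) sd; nra.
have fo1 (y : C) : (forall q, K q -> `|y q| <= 1) ->
    first_order f x y (right_slope f D x y).
  move=> y1 e e0; have [t t0 tH] := unif _ e0; exists t => // s st.
  by have [] := tH y y1 s st.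
have fo (y : C) : exists l, first_order f x y l.
  have [c c0 cy] := compact_scale y cK.
  exists (c^-1 * right_slope f D x (c *: y)).
  have := first_orderZ c^-1 (fo1 _ cy).
  by rewrite scalerA mulVf ?scale1r// gt_eqF.
have [df0 Hdf0] := choice fo.
have absorb (y : C) : exists2 t, 0 < t & forall s, `|s| <= t -> D (x + s *: y).
  have [c c0 cy] := compact_scale y cK.
  exists (r / 2 * c) => [|s]; first by rewrite mulr_gt0// divr_gt0.
  rewrite -ler_pdivrMr// => sr.
  rewrite -[s](divfK (lt0r_neq0 c0)) -scalerA; apply/tD/intube => //.
  by rewrite normrM normfV (gtr0_norm c0).
have lin : linear df0.
  move=> a u v; apply: (first_order_unique (Hdf0 _)).
  by apply: (first_orderD cf absorb) => //; exact: first_orderZ.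
have [df dfE] := linear_bundle lin.
have dfZ (a : R) u : df (a *: u) = a * df u by exact: linearZ_LR.
have Hdf y : first_order f x y (df y) by rewrite dfE.
have {}unif e : 0 < e -> exists2 t : R, 0 < t &
    forall y : C, (forall q, K q -> `|y q| <= 1) -> forall s, `|s| <= t ->
    [/\ tube K r x (x + s *: y) &
      `|f (x + s *: y) - f x - s * df y| <= e * `|s|].
  move=> e0; have [t t0 tH] := unif _ e0; exists t => // y y1 s st.
  by rewrite (first_order_unique (Hdf y) (fo1 _ y1)); exact: tH.
(* In the tube f changes by at most 1 and the first-order error is at most t, so |t df(y)| <= 1 +
   t. *)
have [M M0 dfM] : exists2 M, 0 < M &
    forall y : C, (forall q, K q -> `|y q| <= 1) -> `|df y| <= M.
  have [t t0 tH] := unif 1 ltr01; exists (1 + t^-1) => [|y y1].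
    by rewrite addr_gt0// invr_gt0.
  have tn : `|t| <= t by rewrite gtr0_norm.
  have [ty] := tH _ y1 t tn; have := f1 _ ty; rewrite mul1r (gtr0_norm t0) => H1 H2.
  have : `|t * df y| <= 1 + t.
    rewrite [X in `|X|](_ : _ = (f (x + t *: y) - f x) -
      (f (x + t *: y) - f x - t * df y)); last by ring.
    by rewrite (le_trans (ler_normB _ _))// lerD.
  rewrite normrM (gtr0_norm t0) -ler_pdivlMl//.
  by rewrite mulrDr mulr1 mulVf ?gt_eqF// addrC.
exists df; split; [split|].
- move=> y; apply/(@cvgrPdist_le _ _ _ _ (nbhs_filter y)) => e e0.
  have eM : 0 < e / M by rewrite divr_gt0.
  have := nbhs_tube y cK eM; apply: filterS => z zy.
  rewrite -normrN opprB -raddfB.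
  have Me : 0 < M / e by rewrite divr_gt0.
  have : `|df ((M / e) *: (z - y))| <= M.
    apply: dfM => q Kq; rewrite CkZE CkBE normrM gtr0_norm//.
    by rewrite -ler_pdivlMl// invf_div mulr1; exact/ltW/zy.
  by rewrite dfZ normrM gtr0_norm// -ler_pdivlMl// invf_div divfK// gt_eqF.
- move=> y; apply/cvgrPdist_le => e e0.
  have [t t0 tH] := Hdf y _ e0.
  near=> s; rewrite distrC.
  have s0 : s != 0 by near: s; exact: nbhs_dnbhs_neq.
  have /tH : `|s| <= t by near: s; exact: dnbhs0_le.
  rewrite [X in _ -> `|X| <= _](_ : _ = s^-1 * (f (x + s *: y) - f x - s * df y)).
    by rewrite normrM normfV ler_pdivrMl ?normr_gt0// [_ * e]mulrC.
  by rewrite [in RHS]mulrBr mulKf.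
move=> B bB e e0.
have [b [b0 Bb]] : exists b : R, 0 < b /\ B `<=` [set b *: u | u in tube K 1 0].
  have := bB _ (nbhs_tube 0 cK ltr01).
  by move=> /(filterI (nbhs_pinfty_gt (real0 R)))/filter_ex[b [? ?]]; exists b.
(* The factor b compensates y = b u, and 2 makes the final inequality strict. *)
have e2b : 0 < e / (2 * b) by rewrite divr_gt0// mulr_gt0.
have [t t0 tH] := unif _ e2b.
have tb : 0 < t / b by rewrite divr_gt0.
near=> s => y /Bb[u uK <-].
have s0 : s != 0 by near: s; exact: nbhs_dnbhs_neq.
have st : `|s| <= t / b by near: s; exact: dnbhs0_le.
have u1 q : K q -> `|u q| <= 1.
  by move=> /uK; rewrite Ck0E subr0 => /ltW.
have sbt : `|s * b| <= t by rewrite normrM (gtr0_norm b0) -ler_pdivlMr.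
have [_] := tH u u1 _ sbt.
rewrite scalerA dfZ.
rewrite [X in _ -> `|X| < _](_ : _ =
    s^-1 * (f (x + (s * b) *: u) - f x - s * b * df u)); last first.
  by rewrite [in RHS]mulrBr -mulrA mulKf.
rewrite [`|s^-1 * _|]normrM normfV => H.
have sn : 0 < `|s| by rewrite normr_gt0.
rewrite ltr_pdivrMl// (le_lt_trans H)// normrM (gtr0_norm b0).
rewrite (_ : _ * (_ * b) = e / 2 * `|s|); last by field; rewrite gt_eqF.
by rewrite mulrC ltr_pM2l// ltr_pdivrMr// ltr_pMr// ltr1n.
Unshelve. all: by end_near.
Qed.

End frechet.

(** * The Asplund property *)

Section asplund.
Context {R : realType} {X : ptopologicalType}.
Variable code : X -> nat.
Hypothesis code_inj : injective code.
Hypothesis Xbasis : clopen_basis X.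

(** [exists_almost_smooth] finds, in every neighborhood of a point of D, one point lying in all the
    open sets [O n], so their intersection is dense. *)
Lemma countable_clopen_basis_Asplund : Asplund (Ck R X).
Proof.
move=> D f fD.
pose O n : set (Ck R X) := [set x | almost_smooth f D n.+1%:R^-1 x]°.
have OD n : O n `<=` D.
  move=> x /interior_subset[t t0 /(_ 0)[]]; first exact: sup_le0.
  by rewrite scaler0 addr0.
exists (\bigcap_n O n); split.
- by exists O => // n; exact: open_interior.
- by move=> x /(_ 0%N Logic.I); exact: OD.
- move=> x Dx U xU.
  have [z Uz sz] := exists_almost_smooth code_inj Xbasis fD Dx xU.
  exists z; split => // n _; apply: sz; rewrite invr_gt0 ltr0n//.
- move=> x Gx; have Dx : D x by exact: OD (Gx 0%N Logic.I).
  apply: (frechet_of_almost_smooth fD Dx) => e e0.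
  have [n _ /(_ _ (leqnn n))/= /ltW ne] := near_infty_natSinv_lt (PosNum e0).
  have /interior_subset[t t0 tH] := Gx n Logic.I; exists t => // y /tH[? ? H].
  by split => //; rewrite (le_trans H)// ler_pM2l.
Qed.

End asplund.

(** * A nowhere differentiable convex function on phi *)

Section l1_norm.
Context {R : realType}.
Implicit Types (p q : {poly R}) (a t : R).

Definition l1 p : R := \sum_(i < size p) `|p`_i|.

Lemma l1E n p : (size p <= n)%N -> l1 p = \sum_(i < n) `|p`_i|.
Proof.
move=> pn; rewrite /l1 -(subnKC pn) big_split_ord /= [X in _ + X]big1 ?addr0//.
by move=> i _; rewrite nth_default ?normr0// leq_addr.
Qed.

Lemma l1_ge0 p : 0 <= l1 p.
Proof. exact: sumr_ge0. Qed.

Lemma ler_l1D p q : l1 (p + q) <= l1 p + l1 q.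
Proof.
pose n := maxn (size p) (size q).
rewrite (@l1E n (p + q)) ?size_polyD// (@l1E n p) ?leq_maxl//.
rewrite (@l1E n q) ?leq_maxr// -big_split /=; apply: ler_sum => i _.
by rewrite coefD ler_normD.
Qed.

Lemma l1Z a p : l1 (a *: p) = `|a| * l1 p.
Proof.
rewrite (l1E (size_scale_leq a p)) /l1 mulr_sumr.
by apply: eq_bigr => i _; rewrite coefZ normrM.
Qed.

(** The source of the corner: a monomial beyond the degree of p meets none of its coefficients. *)
Lemma l1D_Xn n p a : (size p <= n)%N -> l1 (p + a *: 'X^n) = l1 p + `|a|.
Proof.
move=> pn; rewrite (@l1E n.+1) ?(leq_trans (size_polyD _ _))//; last first.
  rewrite geq_max (leq_trans pn)//=.
  by rewrite (leq_trans (size_scale_leq _ _))// size_polyXn.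
rewrite big_ord_recr /= (l1E pn); congr (_ + _).
  apply: eq_bigr => i _; rewrite coefD coefZ coefXn ltn_eqF ?mulr0 ?addr0//.
by rewrite coefD coefZ coefXn eqxx mulr1 nth_default// add0r.
Qed.

(** The balls of a norm are absolutely convex and absorbing, hence neighborhoods of 0 in the finest
    topology. *)
Lemma l1_continuous : continuous (l1 : phi R -> R^o).
Proof.
move=> p; apply/(@cvgrPdist_le _ _ _ _ (nbhs_filter (p : phi R))) => e e0.
exists [set q : {poly R} | l1 q <= e].
  split; [split|].
  - apply/convex_setP => x y t t0 t1 /= xe ye.
    rewrite (le_trans (ler_l1D _ _))// !l1Z !ger0_norm ?subr_ge0//.
    have := ler_wpM2l t0 xe; have := @ler_wpM2l _ (1 - t) _ _ _ ye.
    by rewrite subr_ge0 => /(_ t1); lra.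
  - move=> t x t1 /= xe; rewrite l1Z (le_trans _ xe)//.
    by rewrite ler_piMl ?l1_ge0.
  - move=> x; have x0 : 0 < l1 x + 1 by rewrite ltr_wpDl ?l1_ge0.
    exists (e / (l1 x + 1)) => [|t te /=]; first by rewrite divr_gt0.
    rewrite l1Z (le_trans (_ : _ <= `|t| * (l1 x + 1)))//.
      by rewrite ler_wpM2l// lerDl.
    by rewrite -ler_pdivlMr// ltW.
move=> q /= qe.
have := ler_l1D (q - p) p; have := ler_l1D (p - q) q; rewrite !subrK.
have -> : l1 (p - q) = l1 (q - p).
  by rewrite -opprB -scaleN1r l1Z normrN1 mul1r.
by move=> ? ?; rewrite ler_norml; apply/andP; split; lra.
Qed.

Lemma abs_not_differentiable0 (l : R) : ~ (t^-1 * `|t| @[t --> (0 : R)^'] --> l).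
Proof.
move=> /cvgrPdist_lt/(_ 1 ltr01)[e /= e0 H].
have e2 : 0 < e / 2 by rewrite divr_gt0.
have := H (e / 2); have := H (- (e / 2)); rewrite /= !sub0r !normrN gtr0_norm//.
rewrite ltr_pdivrMr// ltr_pMr// ltr1n => /(_ isT) H1 /(_ isT) H2.
have := H1; rewrite oppr_eq0 gt_eqF// => /(_ isT).
have := H2; rewrite gt_eqF// => /(_ isT).
rewrite invrN mulNr mulVf ?gt_eqF// !ltr_norml => /andP[? ?] /andP[? ?].
lra.
Qed.

End l1_norm.

Lemma closure_nonempty (T : topologicalType) (A : set T) :
  closure A !=set0 -> A !=set0.
Proof. by move=> [x /(_ setT filterT)[y [Ay _]]]; exists y. Qed.

Section copies_of_phi.
Context {R : realType} {E : tvsType R} (W : submodClosed E).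
Hypothesis phiW : copy_of_phi W.

Lemma copy_of_phi_nowhere_differentiable : exists psi : sub_lcs W -> R^o,
  [/\ continuous psi, convex_function setT psi &
    forall x, exists y, forall l : R,
      ~ (t^-1 *: (psi (x + t *: y) - psi x) @[t --> (0 : R)^'] --> l)].
Proof.
have [T [S [ST TS _ cS]]] := phiW.
have SDZ (a b : R) x y : S (a *: x + b *: y) = a *: S x + b *: S y.
  by apply: (can_inj ST); rewrite TS linearD !linearZ_LR !TS.
exists (l1 \o S); split.
- by move=> x; apply: continuous_comp; [exact: cS|exact: l1_continuous].
- apply/convex_functionP => x y t t0 t1 _ _ /=; rewrite SDZ.
  by rewrite (le_trans (ler_l1D _ _))// !l1Z !ger0_norm ?subr_ge0.
- move=> x; exists (T 'X^(size (S x))) => l.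
  rewrite (_ : (fun t => _) = (fun t : R => t^-1 * `|t|)).
    exact: abs_not_differentiable0.
  apply/funext => t /=; rewrite -[x in S (x + _)]scale1r SDZ scale1r ST.
  by rewrite l1D_Xn// addrC addKr.
Qed.

Lemma copy_of_phi_not_GDS : ~ GDS (sub_lcs W).
Proof.
have [psi [cpsi vpsi npsi]] := copy_of_phi_nowhere_differentiable.
move=> /(_ setT psi)[].
  split; [by exists 0|exact: openT|exact/convex_setP| |exact: vpsi].
  exact: continuous_subspaceT.
move=> G [_ /(_ 0 Logic.I) G0 dG].
have [x Gx] : G !=set0 by apply: closure_nonempty; exists 0.
have [df [_ dfx]] := dG _ Gx; have [y ny] := npsi x.
exact: ny (dfx y).
Qed.

(** With a projection P onto [W], psi composed with P is convex and continuous on E; its derivative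
    at x along y in [W] would be one of psi at P x. *)
Lemma Asplund_copy_of_phi_not_complemented : Asplund E -> ~ complemented W.
Proof.
have [psi [cpsi vpsi npsi]] := copy_of_phi_nowhere_differentiable.
move=> aE [P [cP PP rP]].
have PW x : P x \in W by move: (rP) => /seteqP[/(_ (P x)) + _]; apply; exists x.
pose Q x : sub_lcs W := exist _ (P x) (PW x).
have QDZ (a b : R) x y : Q (a *: x + b *: y) = a *: Q x + b *: Q y.
  by apply: val_inj; rewrite raddfD /= linearD !linearZ_LR.
have Qval (y : sub_lcs W) : Q (val y) = y.
  apply: val_inj => /=; have : [set` W] (val y) by exact: valP.
  by rewrite -rP => -[z _ <-]; exact: PP.
have cQ : continuous Q by apply: continuous_comp_initial; exact: cP.
have [] := aE setT (psi \o Q).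
  split; [by exists 0|exact: openT|exact/convex_setP| |].
    apply: continuous_subspaceT => x.
    by apply: continuous_comp; [exact: cQ|exact: cpsi].
  apply/convex_functionP => x y t t0 t1 _ _ /=; rewrite QDZ.
  by move/convex_functionP : vpsi; apply.
move=> G [_ _ /(_ 0 Logic.I) G0 dG].
have [x Gx] : G !=set0 by apply: closure_nonempty; exists 0.
have [df [[_ dfx] _]] := dG _ Gx; have [y ny] := npsi (Q x).
apply: (ny (df (val y))); have := dfx (val y).
rewrite (_ : (fun t => _) = (fun t => t^-1 *: (psi (Q x + t *: y) - psi (Q x))))//.
apply/funext => t /=; rewrite -[x in Q (x + _)]scale1r QDZ scale1r.
by rewrite Qval.
Qed.

End copies_of_phi.

(** * A closed copy of phi in C_k(X) *)

Lemma Ck_fun_sum (R : realType) (X : topologicalType) (I : Type) (r : seq I)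
    (P : pred I) (F : I -> Ck R X) q :
  Ck_fun (\sum_(i <- r | P i) F i) q = \sum_(i <- r | P i) F i q.
Proof. by apply: (big_morph (fun g : Ck R X => g q)). Qed.

(** If o is not a cluster point, the filter concentrates on finitely many terms of the sequence. *)
Lemma compact_sequence (X : topologicalType) (o : X) (u : nat -> X) :
  (forall U, nbhs o U -> exists N, forall n, (N <= n)%N -> U (u n)) ->
  compact (o |` range u).
Proof.
move=> uo F FF FK; have [oF|/existsNP[A]] := pselect (cluster F o).
  by exists o; split => //; left.
move=> /existsNP[U] /not_implyP[FA] /not_implyP[oU] nAU.
have [N UN] := uo _ oU.
have fin : finite_set (u @` `I_N) by exact/finite_image/finite_II.
have [|p [[n _ <-] pF]] := finite_compact fin FF.
  apply: filterS (filterI FA FK) => x [Ax [xo|[n _ unx]]].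
    by exfalso; apply: nAU; exists x; split => //; rewrite xo; exact: nbhs_singleton.
  exists n => //=; rewrite ltnNge; apply/negP => Nn.
  by apply: nAU; exists x; split => //; rewrite -unx; exact: UN.
by exists (u n); split => //; right; exists n.
Qed.

Section dyadic_combination.
Context {R : realType} {V : lmodType R}.

(** The weights sum to 1 - 2^-n; the missing mass is put on 0. *)
Lemma dyadic_combination (A : set V) n (v : nat -> V) : convex_set A -> A 0 ->
  (forall i, A (v i)) -> A (\sum_(i < n) (2^-1 : R) ^+ i.+1 *: v i).
Proof.
move=> /convex_setP cA A0; elim: n v => [|n IH] v Av; first by rewrite big_ord0.
have h0 : 0 <= (2^-1 : R) by rewrite invr_ge0.
have h1 : (2^-1 : R) <= 1 by rewrite invf_le1// ler1n.
have := cA _ _ _ h0 h1 (Av 0%N) (IH (v \o succn) (fun i => Av i.+1)).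
have -> : 1 - 2^-1 = 2^-1 :> R by field.
rewrite big_ord_recl expr1 scaler_sumr; congr (A (_ + _)).
by apply: eq_bigr => i _; rewrite scalerA -exprS.
Qed.

End dyadic_combination.

Section copy_of_phi_in_Ck.
Context {R : realType} {X : topologicalType}.
Local Notation C := (Ck R X).
Variables (F : nat -> C) (o : X).
Hypothesis F_disjoint : forall n m q, F n q != 0 -> F m q != 0 -> n = m.
Hypothesis F_shrink : forall U, nbhs o U ->
  exists N, forall n, (N <= n)%N -> forall q, F n q != 0 -> U q.
Hypothesis F_unbounded : forall n M, exists q, M < `|F n q|.
Hypothesis F_o : forall n, F n o = 0.
Implicit Types (g : C) (p : {poly R}).

Let point n : X := projT1 (cid (F_unbounded n 0)).

Let F_point n : F n (point n) != 0.
Proof. by rewrite -normr_gt0 /point; case: cid. Qed.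

Let coord g n : R := g (point n) / F n (point n).

Definition spanF : pred C := [pred g : C | `[< forall q,
  (forall n, F n q != 0 -> g q = coord g n * F n q) /\
  ((forall n, F n q = 0) -> g q = 0) >]].

Let spanFP g : reflect (forall q,
  (forall n, F n q != 0 -> g q = coord g n * F n q) /\
  ((forall n, F n q = 0) -> g q = 0)) (g \in spanF).
Proof. exact: asboolP. Qed.

Let coordD (a : R) g h n : coord (a *: g + h) n = a * coord g n + coord h n.
Proof. by rewrite /coord CkDE CkZE mulrDl mulrA. Qed.

Fact spanF_submod_closed : submod_closed spanF.
Proof.
split=> [|a g h /spanFP gF /spanFP hF].
  apply/spanFP => q; split => // n _.
  by rewrite /coord !Ck0E mul0r mul0r.
apply/spanFP => q; have [g1 g2] := gF q; have [h1 h2] := hF q; split => [n nq|q0].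
  by rewrite CkDE CkZE (g1 _ nq) (h1 _ nq) coordD; ring.
by rewrite CkDE CkZE g2// h2// mulr0 addr0.
Qed.

Definition spanF_submod : submodClosed C :=
  HB.pack (spanF : C -> bool)
    (GRing.isSubmodClosed.Build R C spanF spanF_submod_closed).

Lemma closed_spanF : closed [set` spanF_submod].
Proof.
(* Each condition has the form g q = a g q', with a = 0 off the supports, and is tested on the
   compact set of these two points. *)
have key g q q' (a : R) : closure [set` spanF] g ->
    (forall h, h \in spanF -> h q = a * h q') -> g q = a * g q'.
  move=> cg ha; apply/eqP; rewrite -subr_eq0 -normr_le0.
  apply/ler_addgt0Pl => e e0; rewrite addr0.
  have a0 : 0 < 1 + `|a| by rewrite ltr_pwDl.
  have cK : compact ([set q] `|` [set q']) by apply: compactU; exact: compact_set1.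
  have [h hS hK] : exists2 h : C, h \in spanF &
      tube ([set q] `|` [set q']) (e / (1 + `|a|)) g h.
    by have [h [? ?]] := cg _ (nbhs_tube g cK (divr_gt0 e0 a0)); exists h.
  have := ha _ hS; have := hK q (or_introl erefl); have := hK q' (or_intror erefl).
  move=> H' H hq.
  rewrite (_ : g q - a * g q' = a * (h q' - g q') - (h q - g q)); last first.
    by rewrite hq; ring.
  rewrite (le_trans (ler_normB _ _))// normrM.
  rewrite (_ : e = `|a| * (e / (1 + `|a|)) + e / (1 + `|a|)); last first.
    by field; rewrite gt_eqF.
  by rewrite lerD ?ler_wpM2l// ltW.
move=> g cg; apply/spanFP => q; split => [n nq|q0].
  rewrite /coord mulrAC -mulrA mulrC.
  apply: key cg _ => h /spanFP/(_ q)[+ _].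
  by move=> /(_ _ nq) ->; rewrite /coord mulrAC -mulrA mulrC.
have := @key g q q 0 cg; rewrite !mul0r; apply => h /spanFP/(_ q)[_ ->] //.
by rewrite mul0r.
Qed.

Let embed p : C := \sum_(i < size p) p`_i *: F i.

Let embedE n p : (size p <= n)%N -> embed p = \sum_(i < n) p`_i *: F i.
Proof.
move=> pn; rewrite /embed -(subnKC pn) big_split_ord /= [X in _ + X]big1 ?addr0//.
by move=> i _; rewrite nth_default ?scale0r// leq_addr.
Qed.

Let embed_linear : linear embed.
Proof.
move=> a p q; pose n := maxn (size (a *: p)) (size q).
have pn : (size p <= maxn n (size p))%N by rewrite leq_maxr.
have qn : (size q <= maxn n (size p))%N by rewrite /n !leq_max leqnn orbT.
have pqn : (size (a *: p + q)%R <= maxn n (size p))%N.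
  by rewrite (leq_trans (size_polyD _ _))// leq_maxl.
rewrite (embedE pn) (embedE qn) (embedE pqn) scaler_sumr -big_split /=.
by apply: eq_bigr => i _; rewrite coefD coefZ scalerDl scalerA.
Qed.

Let embed_in p n q : F n q != 0 -> embed p q = p`_n * F n q.
Proof.
move=> nq; rewrite (embedE (leq_maxl (size p) n.+1)) Ck_fun_sum.
have nn : (n < maxn (size p) n.+1)%N by rewrite leq_maxr.
rewrite (bigD1 (Ordinal nn))// big1 => [|i ni].
  by rewrite CkZE; exact: addr0.
rewrite CkZE; have [->|iq] := eqVneq (F i q) 0; first by rewrite mulr0.
by move: ni; rewrite -val_eqE /= (F_disjoint iq nq) eqxx.
Qed.

Let embed_out p q : (forall n, F n q = 0) -> embed p q = 0.
Proof.
by move=> q0; rewrite /embed Ck_fun_sum big1// => i _; rewrite CkZE q0 mulr0.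
Qed.

Let embed_coord p n : coord (embed p) n = p`_n.
Proof. by rewrite /coord (embed_in p (F_point n)) mulfK. Qed.

Let embed_spanF p : embed p \in spanF.
Proof.
apply/spanFP => q; split; last exact: embed_out.
by move=> n nq; rewrite embed_coord; exact: embed_in.
Qed.

(** A nonzero coordinate makes |g| exceed 1 somewhere on the support of F_n, which for large n lies
    where continuity and g o = 0 force |g| < 1. *)
Let coord_eventually0 g : g \in spanF ->
  exists N, forall n, (N <= n)%N -> coord g n = 0.
Proof.
move=> /spanFP gF.
have go : g o = 0 by apply: (gF o).2 => n; exact: F_o.
have : nbhs o [set q | `|g q| < 1].
  have /cvgrPdist_lt/(_ 1 ltr01) := @Ck_continuous R X g o.
  by apply: filterS => q; rewrite go sub0r normrN.
move=> /F_shrink[N HN]; exists N => n Nn; apply/eqP; apply: contrapT => /negP cn.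
have [q nq] := F_unbounded n `|coord g n|^-1.
have q0 : F n q != 0 by rewrite -normr_gt0 (le_lt_trans _ nq)// invr_ge0.
have := HN _ Nn _ q0; rewrite /= ((gF q).1 _ q0) normrM -ltr_pdivlMl ?normr_gt0//.
by rewrite mulr1 => /lt_trans/(_ nq); rewrite ltxx.
Qed.

Let embed_surj g : g \in spanF -> exists p, embed p = g.
Proof.
move=> gS; have [N cN] := coord_eventually0 gS; have /spanFP gF := gS.
exists (\poly_(i < N) coord g i); apply: Ck_eqP => q.
have [[n nq]|q0] := pselect (exists n, F n q != 0).
  rewrite (embed_in _ nq) ((gF q).1 _ nq) coef_poly.
  by case: ltnP => // /cN ->.
have {}q0 n : F n q = 0.
  by apply/eqP; apply: contrapT => /negP nq; apply: q0; exists n.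
by rewrite embed_out// (gF q).2.
Qed.

Lemma copy_of_phi_spanF : copy_of_phi spanF_submod.
Proof.
pose T0 p : sub_lcs spanF_submod := exist _ (embed p) (embed_spanF p).
have T0lin : linear T0.
  by move=> a p q; apply: val_inj; rewrite raddfD /= embed_linear.
have [T TE] := linear_bundle T0lin.
have /choice[S ST] : forall w : sub_lcs spanF_submod, exists p, T p = w.
  move=> [g gS]; have [p pg] := embed_surj gS; exists p.
  by apply: val_inj; rewrite TE.
have Tinj : injective T.
  move=> p q /(congr1 val); rewrite !TE /= => pq; apply/polyP => n.
  by rewrite -!embed_coord pq.
have TS : cancel T S by move=> p; apply: Tinj; exact: ST.
exists T, S; split => //; first exact: finest_lcs_continuous.
move=> w U [A [[cA bA] aA] AU].
have /choice[d Hd] : forall n, exists d : R, 0 < d /\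
    forall t, `|t| < d -> A (t *: 'X^n).
  by move=> n; have [d d0 dH] := aA 'X^n; exists d.
(* An element of the span smaller than 1 at [u n] has n-th coordinate below d_n / 2^(n+1), so
   [dyadic_combination] puts its polynomial in [A]. *)
have /choice[u Hu] n := F_unbounded n (2 ^+ n.+1 / d n).
have u0 n : F n (u n) != 0.
  rewrite -normr_gt0 (le_lt_trans _ (Hu n))// divr_ge0// ?exprn_ge0//.
  exact/ltW/(Hd n).1.
have cK : compact (o |` range u).
  apply: compact_sequence => V /F_shrink[N HN]; exists N => n Nn; exact: HN (u0 n).
have NK : nbhs w (val @^-1` tube (o |` range u) 1 (val w)).
  exact: (@initial_continuous (sub_lcs spanF_submod) C val w _ (nbhs_tube _ cK ltr01)).
apply: (@filterS _ (nbhs w) (nbhs_filter w) _ _ _ NK) => w' w'K; apply: AU.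
pose p : {poly R} := S w' - S w.
have pE : embed p = val w' - val w.
  have Tp : T p = w' - w.
    apply: etrans (raddfB T (S w') (S w)) _.
    by congr (_ - _); exact: ST.
  by rewrite -raddfB -Tp TE.
have pn n : `|2 ^+ n.+1 * p`_n| < d n.
  have := w'K (u n) (or_intror (ex_intro2 _ _ n Logic.I erefl)).
  rewrite -CkBE -pE (embed_in _ (u0 n)) !normrM => H.
  have := Hu n; rewrite ltr_pdivrMr ?(Hd n).1// ger0_norm ?exprn_ge0// => H2.
  have := (Hd n).1 => d0.
  have [->|pn0] := eqVneq p`_n 0; first by rewrite normr0 mulr0.
  have pp : 0 < `|p`_n| by rewrite normr_gt0.
  nra.
have A0 : A 0 by have := (Hd 0%N).2 0; rewrite scale0r normr0; apply; exact: (Hd 0%N).1.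
rewrite -/p -[p]coefK poly_def.
rewrite (eq_bigr (fun i : 'I_(size p) =>
    2^-1 ^+ i.+1 *: ((2 ^+ i.+1 * p`_i) *: 'X^i))); last first.
  by move=> i _; rewrite scalerA mulrA -exprMn mulVf// expr1n mul1r.
apply: (@dyadic_combination _ _ A (size p)
  (fun i => (2 ^+ i.+1 * p`_i) *: 'X^i) cA A0) => i.
exact: (Hd i).2.
Qed.

End copy_of_phi_in_Ck.

(** * The rational line *)

Section rational_line.
Context {R : realType}.
Implicit Types (a b : R) (q : rat^o).

Lemma ratr_continuous : continuous (ratr : rat^o -> R^o).
Proof.
move=> x; apply/cvgrPdist_lt => e e0.
have [d] := rat_in_itvoo e0; rewrite in_itv /= => /andP[d0 de].
rewrite (ltr0q R d) in d0.
apply: filterS (nbhsx_ballx x d d0) => y.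
rewrite /ball /= => xy; rewrite -rmorphB -ratr_norm (lt_trans _ de)//.
by rewrite ltr_rat.
Qed.

Lemma irrational_neq a q : irrational a -> ratr q != a.
Proof. by move=> ia; apply/eqP => qa; apply: ia; exists q. Qed.

Lemma irrational_pi (p q : rat) : q != 0 -> irrational (ratr p + ratr q * pi : R).
Proof.
move=> q0 [z _ zE]; apply: (@pi_irrationnal R); exists ((z - p) / q) => //.
rewrite fmorph_div rmorphB/= zE addrAC subrr add0r mulrC mulKf//.
by rewrite fmorph_eq0.
Qed.

Lemma irrational_between a b : a < b ->
  exists s, [/\ a < s, s < b & irrational s].
Proof.
move=> /rat_in_itvoo[p]; rewrite in_itv /= => /andP[ap pb].
have : 0 < (b - ratr p) / pi by rewrite divr_gt0 ?pi_gt0// subr_gt0.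
move=> /rat_in_itvoo[q]; rewrite in_itv /= => /andP[q0 qb].
exists (ratr p + ratr q * pi); split.
- by rewrite (lt_trans ap)// ltrDl mulr_gt0// pi_gt0.
- by rewrite -ltrBrDl -ltr_pdivlMr// pi_gt0.
- by apply: irrational_pi; rewrite gt_eqF// -(ltr0q R).
Qed.

(** The open and the closed interval with irrational endpoints have the same rational points. *)
Lemma irrational_itv_clopen a b : irrational a -> irrational b ->
  clopen ([set q | a < ratr q /\ ratr q < b] : set rat^o).
Proof.
move=> ia ib.
have /continuousP oc := ratr_continuous.
have /continuous_closedP cc := ratr_continuous.
split.
  rewrite (_ : [set _ | _] = ratr @^-1` (`]a, b[%classic : set R^o)).
    by apply: oc; exact: interval_open.
  apply/seteqP; split => q; rewrite /= in_itv /=; first by move=> [-> ->].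
  by move=> /andP[].
rewrite (_ : [set _ | _] = ratr @^-1` (`[a, b]%classic : set R^o)).
  by apply: cc; exact: interval_closed.
apply/seteqP; split => q; rewrite /= in_itv /=; first by move=> [/ltW -> /ltW ->].
by rewrite !le_eqVlt eq_sym !(negPf (irrational_neq _ _))//= => /andP[].
Qed.

End rational_line.

Lemma rat_clopen_basis (R : realType) : clopen_basis rat^o.
Proof.
move=> x U /nbhs_ballP[d /= d0 dU].
have xd : ratr (x - d) < ratr x :> R by rewrite ltr_rat gtrBl.
have dx : ratr x < ratr (x + d) :> R by rewrite ltr_rat ltrDl.
have [a [xa ax ia]] := irrational_between xd.
have [b [xb bx ib]] := irrational_between dx.
exists [set q | a < ratr q /\ ratr q < b]; split => //.
  exact: irrational_itv_clopen.
move=> q [aq qb]; apply: dU; rewrite /ball /= ltr_distlC.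
by rewrite -(ltr_rat R) -[X in _ && X](ltr_rat R) (lt_trans xa)// (lt_trans qb).
Qed.

(** * Unbounded functions on disjoint clopen intervals *)

Section unbounded_functions.
Context {R : realType}.
Local Notation C := (Ck R rat^o).

(** Irrational endpoints decreasing to 0. *)
Let s n : R := pi / n.+1%:R.

Let s_gt0 n : 0 < s n.
Proof. by rewrite divr_gt0// pi_gt0. Qed.

Let s_le m n : (m <= n)%N -> s n <= s m.
Proof.
move=> mn; rewrite ler_pM2l ?pi_gt0// lef_pV2 ?posrE// ler_nat; exact: mn.
Qed.

Let s_lt n : s n.+1 < s n.
Proof. by rewrite ltr_pM2l ?pi_gt0// ltf_pV2 ?posrE// ltr_nat. Qed.

Let s_irrational n : irrational (s n).
Proof.
have := @irrational_pi R 0 n.+1%:R^-1.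
rewrite rmorph0 add0r fmorphV rmorph_nat mulrC; apply.
by rewrite invr_eq0.
Qed.

Let spike_continuous n : continuous (fun q : rat^o => (s n - ratr q)^-1 : R^o).
Proof.
move=> q; apply: cvgV.
  by rewrite subr_eq0 eq_sym; exact: irrational_neq.
by apply: cvgB; [exact: cvg_cst|exact: ratr_continuous].
Qed.

(** The pole sits at the irrational endpoint [s n], so the function is continuous on the rationals
    yet unbounded. *)
Definition spike n : C :=
  restr (irrational_itv_clopen (@s_irrational n.+1) (@s_irrational n))
    (mkCk (@spike_continuous n)).

Let spike_supp n q : spike n q != 0 -> s n.+1 < ratr q /\ ratr q < s n.
Proof.
move=> nq; apply: contrapT => nA; move: nq.
by rewrite /spike restr_out ?eqxx.
Qed.

Let spikeE n (q : rat^o) : s n.+1 < ratr q -> ratr q < s n ->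
  Ck_fun (spike n) q = (s n - ratr q)^-1.
Proof. by move=> q1 q2; apply: restr_in. Qed.

Lemma spike_disjoint n m q : spike n q != 0 -> spike m q != 0 -> n = m.
Proof.
wlog nm : n m / (n < m)%N => [H nq mq|].
  have [nm|mn|//] := ltngtP n m; first exact: (H n m).
  by apply/esym; exact: (H m n).
move=> /spike_supp[nq _] /spike_supp[_ qm].
by have := lt_le_trans (lt_trans nq qm) (s_le nm); rewrite ltxx.
Qed.

Lemma spike_shrink U : nbhs (0 : rat^o) U ->
  exists N, forall n, (N <= n)%N -> forall q, spike n q != 0 -> U q.
Proof.
move=> /nbhs_ballP[d /= d0 dU].
have dpi : 0 < ratr d / pi :> R by rewrite divr_gt0 ?pi_gt0// ltr0q.
have [N _ /(_ _ (leqnn N)) /= Nd] := near_infty_natSinv_lt (PosNum dpi).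
exists N => n Nn q /spike_supp[q1 q2]; apply: dU.
rewrite /ball /= sub0r normrN ger0_norm; last first.
  by rewrite -(ler0q R) (le_trans (ltW (s_gt0 n.+1)))// ltW.
rewrite -(ltr_rat R) (lt_trans q2)// (le_lt_trans (s_le Nn))//.
by rewrite /s mulrC -ltr_pdivlMr// pi_gt0.
Qed.

Lemma spike_unbounded n (M : R) : exists q : rat^o, M < `|Ck_fun (spike n) q|.
Proof.
have M0 : 0 < `|M| + 1 by rewrite ltr_wpDl.
(* At a rational this close to the pole the value exceeds |M| + 1. *)
have : Num.max (s n.+1) (s n - (`|M| + 1)^-1) < s n.
  by rewrite gt_max s_lt gtrBl invr_gt0.
move=> /rat_in_itvoo[q]; rewrite in_itv /= gt_max => /andP[/andP[q1 q2] q3].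
have sq : 0 < s n - ratr q by rewrite subr_gt0.
suff : M < `|Ck_fun (spike n) (q : rat^o)| by exists q.
rewrite spikeE// gtr0_norm ?invr_gt0//.
rewrite (le_lt_trans (ler_norm M))// (@lt_trans _ _ (`|M| + 1)) ?ltrDl//.
by rewrite -[ltLHS]invrK ltf_pV2 ?posrE ?invr_gt0// ltrBlDr -ltrBlDl.
Qed.

Lemma spike0 n : Ck_fun (spike n) 0 = 0.
Proof.
rewrite /spike restr_out// => -[/= + _]; rewrite rmorph0.
by rewrite ltNge ltW.
Qed.

End unbounded_functions.

Theorem corollary3p13 (R : realType) :
  [/\ exists W : submodClosed (Ck R rat^o), copy_of_phi W,
      forall W : submodClosed (Ck R rat^o), copy_of_phi W -> ~ complemented W,
      Asplund (Ck R rat^o) &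
      exists W : submodClosed (Ck R rat^o),
        [/\ closed [set` W], copy_of_phi W & ~ GDS (sub_lcs W)]].
Proof.
have aQ : Asplund (Ck R rat^o).
  exact: (@countable_clopen_basis_Asplund R rat^o pickle (pcan_inj pickleK)
    (rat_clopen_basis R)).
pose W := spanF_submod (@spike_unbounded R).
have phiW : copy_of_phi W.
  exact: (copy_of_phi_spanF (@spike_disjoint R) (@spike_shrink R)
    (@spike_unbounded R) (@spike0 R)).
split.
- by exists W.
- by move=> V phiV; exact: Asplund_copy_of_phi_not_complemented.
- exact: aQ.
- exists W; split; [exact: closed_spanF|exact: phiW|].
  exact: copy_of_phi_not_GDS.
Qed.
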